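(* Let $n\ge 2$ be an integer and let $\mathrm{UT}_n\mathbb{R}$ be the Lie group of real $n\times n$ unitriangular matrices, with the coordinates $(x^{ij})_{1\le i<j\le n}$ and left-invariant coframe $\{\theta^{ij}\}_{1\le i<j\le n}$ described in the context. Then the family of diagonal metrics $$ g(t) = \sum_{1\le i<j\le n} g_{ij,ij}(t)\,\theta^{ij}\otimes\theta^{ij}, \qquad g_{ij,ij}(t) = \frac{1}{n^{\,j-i-1}}\,t^{\,1-2(j-i)/n}, \qquad t>0, $$ is a Ricci flow solution on $\mathrm{UT}_n\mathbb{R}$. The metric $g(1)$ is a nilsoliton with respect to the diffeomorphisms $\eta_t$ of $\mathrm{UT}_n\mathbb{R}$, $t>0$, given by $$ (\eta_t(x))^{ij} = t^{-(j-i)/n}\,x^{ij}, $$ i.e. $g(t) = t\,\eta_t^* g(1)$.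
   Context: $\mathrm{UT}_n\mathbb{R}\subset \mathrm{SL}_n\mathbb{R}$ is the group, under matrix multiplication, of real $n\times n$ matrices with $1$ on the diagonal and $0$ below the diagonal. The global coordinates $(x^{ij})_{1\le i<j\le n}$ are the entries strictly above the diagonal. The left-invariant frame is $$F_{ij} = \partial_{ij} + \sum_{k<i} x^{ki}\,\partial_{kj}, \qquad 1\le i<j\le n,\quad \partial_{ij} = \frac{\partial}{\partial x^{ij}},$$ which satisfies the same bracket relations as the elementary matrices $B_{ij}$ (the matrix with $1$ in entry $(i,j)$ and $0$ elsewhere): $[B_{ij},B_{kl}] = \delta_{jk}B_{il} - \delta_{il}B_{kj}$. The coframe $\{\theta^{ij}\}$ is the left-invariant coframe dual to $\{F_{ij}\}$. A Ricci flow solution is a one-parameter family of Riemannian metrics with $\frac{d}{dt}g = -2\,\mathrm{Rc}(g)$. A left-invariant metric $g$ on a nilpotent Lie group is a nilsoliton (with respect to diffeomorphisms $\eta_t$) if $g(t) = c(t)\,\eta_t^*g$ is a solution of Ricci flow for some function $c(t)$ and a one-parameter family of diffeomorphisms $\{\eta_t\}$; it is expanding if $c(t)=t$. *)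

(* Defs.v *)
From HB Require Import structures.
From mathcomp Require Import all_boot all_order all_algebra.
From mathcomp Require Import all_classical all_reals all_analysis.

Set Implicit Arguments.
Unset Strict Implicit.
Unset Printing Implicit Defensive.

Import Order.TTheory GRing.Theory Num.Theory.
Import numFieldNormedType.Exports.

Local Open Scope classical_set_scope.
Local Open Scope ring_scope.

(** * Riemannian geometry in a global chart

    A manifold with a global chart is identified with R^m ('rV[R]_m); tangent
    vectors and covectors are row vectors of components in the coordinate frame
    and coframe, and a 2-tensor field g has components g x i j. *)
Section Geometry.
Context {R : realType} {m : nat}.
Implicit Types (f : 'rV[R]_m -> R) (phi psi : 'rV[R]_m -> 'rV[R]_m).
Implicit Types (g : 'rV[R]_m -> 'M[R]_m) (x : 'rV[R]_m).

Definition partial f (i : 'I_m) x : R := 'D_(delta_mx 0 i) f x.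

Fixpoint Ck (k : nat) f : Prop :=
  continuous f /\
  if k is k'.+1 then
    forall i, (forall x, derivable f x (delta_mx 0 i)) /\ Ck k' (partial f i)
  else True.

Definition smooth f : Prop := forall k, Ck k f.

Definition smooth_map phi : Prop := forall j, smooth (fun x => phi x 0 j).

Definition diffeomorphism phi : Prop :=
  exists psi, [/\ cancel phi psi, cancel psi phi, smooth_map phi & smooth_map psi].

Definition riemannian_metric g : Prop :=
  [/\ forall i j, smooth (fun x => g x i j),
      forall x, (g x)^T = g x &
      forall x (v : 'rV[R]_m), v != 0 -> 0 < (v *m g x *m v^T) 0 0].

(** The symbol Gamma^k_{ij} is [christoffel g k i j]. *)
Definition christoffel g (k i j : 'I_m) x : R :=
  2^-1 * \sum_l invmx (g x) k l *
    (partial (fun y => g y j l) i x + partial (fun y => g y i l) j x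
     - partial (fun y => g y i j) l x).

(** The component of R(d_i, d_j) d_k along d_l, for
    R(X, Y) Z = nabla_X nabla_Y Z - nabla_Y nabla_X Z - nabla_[X,Y] Z. *)
Definition riemann g (i j k l : 'I_m) x : R :=
  partial (christoffel g l j k) i x - partial (christoffel g l i k) j x
  + \sum_p (christoffel g p j k x * christoffel g l i p x
            - christoffel g p i k x * christoffel g l j p x).

(** Rc(Y, Z) is the trace of X |-> R(X, Y) Z. *)
Definition ricci g x : 'M[R]_m := \matrix_(j, k) \sum_i riemann g i j k i x.

Definition ricci_flow (D : set R) (g : R -> 'rV[R]_m -> 'M[R]_m) : Prop :=
  forall t, D t ->
    riemannian_metric (g t) /\
    forall x i j, is_derive t 1 (fun s => g s x i j) (- 2 * ricci (g t) x i j).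

(** (phi^* g)_{ij}(x) = sum_{k,l} d_i phi^k(x) d_j phi^l(x) g_{kl}(phi(x)). *)
Definition pullback phi g x : 'M[R]_m :=
  let J := \matrix_(i, k) partial (fun y => phi y 0 k) i x in
  J *m g (phi x) *m J^T.

Definition tensor (u v : 'rV[R]_m) : 'M[R]_m := u^T *m v.

End Geometry.

(** * The unitriangular group *)

Definition pos (n : nat) : Type := {p : 'I_n * 'I_n | (p.1 < p.2)%N}.
HB.instance Definition _ n := Finite.on (pos n).

Section Unitriangular.
Context {R : realType} {n : nat}.

(** The coordinates x^{ij}, i < j, are enumerated by the elements of [pos n]. *)
Definition dimUT : nat := #|{: pos n}|.
Definition prow (a : 'I_dimUT) : 'I_n := (val (enum_val a)).1.
Definition pcol (a : 'I_dimUT) : 'I_n := (val (enum_val a)).2.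

Definition unitriangular (A : 'M[R]_n) : Prop :=
  (forall i, A i i = 1) /\ (forall i j : 'I_n, (j < i)%N -> A i j = 0).

Definition UTmx (x : 'rV[R]_dimUT) : 'M[R]_n :=
  1%:M + \sum_a x 0 a *: delta_mx (prow a) (pcol a).
Definition UTcoord (A : 'M[R]_n) : 'rV[R]_dimUT := \row_a A (prow a) (pcol a).

Definition UTmul (x y : 'rV[R]_dimUT) : 'rV[R]_dimUT :=
  UTcoord (UTmx x *m UTmx y).

Definition left_invariant (g : 'rV[R]_dimUT -> 'M[R]_dimUT) : Prop :=
  forall a, pullback (UTmul a) g = g.

(** The coordinate vector field d_{ij}; it is only used for i < j. *)
Definition dcoord (i j : 'I_n) : 'rV[R]_dimUT :=
  \row_a ((prow a == i) && (pcol a == j))%:R.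

Definition frame (x : 'rV[R]_dimUT) (i j : 'I_n) : 'rV[R]_dimUT :=
  dcoord i j + \sum_(k < n | (k < i)%N) UTmx x k i *: dcoord k j.

Definition frame_mx (x : 'rV[R]_dimUT) : 'M[R]_dimUT :=
  \matrix_a frame x (prow a) (pcol a).

(** The rows of [(invmx F)^T] are dual to the rows of [F]; see [coframe_dual]. *)
Definition coframe (x : 'rV[R]_dimUT) (a : 'I_dimUT) : 'rV[R]_dimUT :=
  row a (invmx (frame_mx x))^T.

Definition nilsoliton (D : set R) (g : 'rV[R]_dimUT -> 'M[R]_dimUT)
    (eta : R -> 'rV[R]_dimUT -> 'rV[R]_dimUT) : Prop :=
  [/\ riemannian_metric g, left_invariant g,
      forall t, D t -> diffeomorphism (eta t) &
      exists c : R -> R,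
        ricci_flow D (fun t x => c t *: pullback (eta t) g x)].

Lemma prow_lt_pcol (a : 'I_dimUT) : (prow a < pcol a)%N.
Proof. exact: (valP (enum_val a)). Qed.

Lemma pos_inj (a b : 'I_dimUT) : prow a = prow b -> pcol a = pcol b -> a = b.
Proof.
rewrite /prow /pcol => h1 h2; apply: enum_val_inj; apply: val_inj.
by move: h1 h2; case: (val (enum_val a)) (val (enum_val b)) => [? ?] [? ?] /= -> ->.
Qed.

Lemma pos_surj (i j : 'I_n) : (i < j)%N ->
  exists a : 'I_dimUT, prow a = i /\ pcol a = j.
Proof.
move=> ij; pose p : pos n := exist _ (i, j) ij.
by exists (enum_rank p); rewrite /prow /pcol enum_rankK.
Qed.

Let sum_delta (v : 'rV[R]_dimUT) (i j : 'I_n) :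
  (\sum_a v 0 a *: delta_mx (prow a) (pcol a) : 'M[R]_n) i j =
  \sum_a v 0 a * ((i == prow a) && (j == pcol a))%:R.
Proof. by rewrite summxE; apply: eq_bigr => a _; rewrite !mxE. Qed.

Let sum_delta_pos (v : 'rV[R]_dimUT) a :
  (\sum_b v 0 b *: delta_mx (prow b) (pcol b) : 'M[R]_n) (prow a) (pcol a) = v 0 a.
Proof.
rewrite sum_delta (bigD1 a) //= !eqxx mulr1 big1 ?addr0 // => b ba.
case: (prow a =P prow b) => [e1|]; last by rewrite mulr0.
case: (pcol a =P pcol b) => [e2|]; last by rewrite mulr0.
by rewrite (pos_inj e1 e2) eqxx in ba.
Qed.

Let sum_delta_low (v : 'rV[R]_dimUT) (i j : 'I_n) : (j <= i)%N ->
  (\sum_b v 0 b *: delta_mx (prow b) (pcol b) : 'M[R]_n) i j = 0.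
Proof.
move=> ji; rewrite sum_delta big1 // => a _.
case: andP => [[/eqP ei /eqP ej]|]; last by rewrite mulr0.
by have := prow_lt_pcol a; rewrite -ei -ej ltnNge ji.
Qed.

Lemma UTmx_unitriangular x : unitriangular (UTmx x).
Proof.
split=> [i|i j ji]; rewrite /UTmx [LHS]mxE sum_delta_low ?addr0 ?mxE ?eqxx //.
- by case: eqP => // e; rewrite e ltnn in ji.
- exact: ltnW.
Qed.

Lemma UTmxK : cancel UTmx UTcoord.
Proof.
move=> x; apply/rowP => a; rewrite mxE /UTmx [LHS]mxE sum_delta_pos mxE.
by case: eqP => [e|]; rewrite ?add0r //; have := prow_lt_pcol a; rewrite e ltnn.
Qed.

Lemma UTcoordK A : unitriangular A -> UTmx (UTcoord A) = A.
Proof.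
move=> [A1 A0]; have [U1 U0] := UTmx_unitriangular (UTcoord A).
apply/matrixP => i j; case: (ltngtP i j) => [ij|ji|/val_inj <-].
- have [a [<- <-]] := pos_surj ij.
  by have /rowP/(_ a) := UTmxK (UTcoord A); rewrite !mxE.
- by rewrite U0 ?A0.
- by rewrite U1 A1.
Qed.

Lemma unitriangularM A B :
  unitriangular A -> unitriangular B -> unitriangular (A *m B).
Proof.
move=> [A1 A0] [B1 B0]; split=> [i|i j ji]; rewrite mxE.
  rewrite (bigD1 i) //= A1 B1 mulr1 big1 ?addr0 // => k ki.
  case: (ltngtP k i) => [h|h|/val_inj h]; first by rewrite A0 ?mul0r.
    by rewrite B0 ?mulr0.
  by rewrite h eqxx in ki.
rewrite big1 // => k _; case: (ltnP k i) => [h|h]; first by rewrite A0 ?mul0r.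
by rewrite B0 ?mulr0 //; exact: leq_trans h.
Qed.

Lemma UTmxM x y : UTmx (UTmul x y) = UTmx x *m UTmx y.
Proof. by apply/UTcoordK/unitriangularM; exact: UTmx_unitriangular. Qed.

Let toM (v : 'rV[R]_dimUT) : 'M[R]_n := \sum_a v 0 a *: delta_mx (prow a) (pcol a).

(** As a matrix, F_{ij} at x is x B_{ij}. *)
Lemma frameE x a :
  \sum_b frame x (prow a) (pcol a) 0 b *: delta_mx (prow b) (pcol b) =
  UTmx x *m delta_mx (prow a) (pcol a).
Proof.
have [U1 U0] := UTmx_unitriangular x.
set i := prow a; set j := pcol a.
have rhs (A : 'M[R]_n) k l : (A *m delta_mx i j) k l = A k i * (l == j)%:R.
  rewrite mxE (bigD1 i) //= [X in _ * X]mxE eqxx /= big1 ?addr0 // => p pi.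
  by rewrite [X in _ * X]mxE (negbTE pi) mulr0.
apply/matrixP => k l; rewrite rhs; case: (ltnP k l) => [kl|lk].
  have [b [<- <-]] := pos_surj kl; rewrite sum_delta_pos.
  rewrite /frame [LHS]mxE [X in X + _]mxE summxE.
  have -> : \sum_(k < n | (k < i)%N) (UTmx x k i *: dcoord k j) 0 b =
     \sum_(k < n | (k < i)%N && (k == prow b)) UTmx x k i * (pcol b == j)%:R.
    rewrite [RHS]big_mkcondr; apply: eq_bigr => p _.
    rewrite [LHS]mxE [X in _ * X]mxE (eq_sym p).
    by case: eqP => //=; rewrite mulr0.
  case: (ltngtP (prow b) i) => [h|h|/val_inj h].
  - rewrite (bigD1 (prow b)) ?h ?eqxx //= big1 ?addr0.
      by rewrite (_ : (prow b == i) = false) ?add0r //; apply: contraTF h => /eqP ->; rewrite ltnn.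
    by move=> p /andP[/andP[_ ->]].
  - rewrite U0 // mul0r big1 ?addr0.
      by rewrite (_ : (prow b == i) = false) //; apply: contraTF h => /eqP ->; rewrite ltnn.
    by move=> p /andP[pi /eqP e]; move: pi; rewrite e ltnNge ltnW.
  - rewrite h eqxx U1 mul1r big1 ?addr0 //.
    by move=> p /andP[pi /eqP e]; move: pi; rewrite e ltnn.
rewrite sum_delta_low //; case: eqP => [e|]; last by rewrite mulr0.
rewrite U0 ?mul0r // -/i (leq_trans _ lk) // e; exact: prow_lt_pcol.
Qed.

Lemma frame_mx_unit x : frame_mx x \in unitmx.
Proof.
rewrite -row_free_unit -kermx_eq0; apply/rowV0P => v /sub_kermxP v0.
have Uu : UTmx x \in unitmx.
  have [U1 U0] := UTmx_unitriangular x.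
  rewrite unitmxE -det_tr det_trig; last first.
    by apply/is_trig_mxP => i j ij; rewrite mxE U0.
  by rewrite big1 ?unitr1 // => i _; rewrite mxE U1.
have : UTmx x *m toM v = 0.
  rewrite mulmx_sumr.
  under eq_bigr => a _ do rewrite -scalemxAr -frameE scaler_sumr.
  rewrite exchange_big /= big1 // => b _.
  under eq_bigr => a _ do rewrite scalerA.
  rewrite -scaler_suml; move/rowP/(_ b): v0; rewrite !mxE => e.
  rewrite (eq_bigr (fun a => v 0 a * frame_mx x a b)) ?e ?scale0r // => a _.
  by rewrite [frame_mx _ _ _]mxE.
move/(congr1 (mulmx (invmx (UTmx x)))); rewrite mulKmx // mulmx0 => e.
by apply/rowP => a; rewrite -(sum_delta_pos v a) -/(toM v) e !mxE.
Qed.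

Lemma coframe_dual x a b :
  (coframe x a *m (frame x (prow b) (pcol b))^T) 0 0 = (a == b)%:R.
Proof.
have /matrixP/(_ b a) := mulmxV (frame_mx_unit x).
rewrite [in X in _ = X -> _]mxE eq_sym => <-; rewrite !mxE.
by apply: eq_bigr => k _; rewrite !mxE mulrC.
Qed.

End Unitriangular.
Arguments dimUT : clear implicits.

(* Main.v *)
Require Import Defs.
From mathcomp Require Import all_boot all_order all_algebra.
From mathcomp Require Import all_classical all_reals all_analysis.
From mathcomp Require Import zify ring.

(** The left-invariant field F_a is x B_a at the matrix x, where the B_a are the
    elementary matrices. A diagonal metric therefore has, in the frame of the
    F_a, constant components, and its Levi-Civita connection is constant in that
    frame, given by Koszul's formula. The coordinate Christoffel symbols arise
    from this constant connection by the gauge transformation E, the matrix of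
    the frame ([frame_christoffel]); the curvature transforms by conjugation
    ([gauge_curvature]), and [ricci_frame] reduces the Ricci tensor to algebra
    in the structure constants C_bc^a.

    In a unimodular Lie algebra with vanishing Killing form, such as a nilpotent
    one, that algebra simplifies ([ricci_koszul]), with w_a the squared length
    of F_a, to

      Rc(F_c, F_d) = 1/4 sum_(b,e) C_be^c C_be^d w_c w_d / (w_b w_e)
                     - 1/2 sum_(b,e) C_cb^e C_db^e w_e / w_b.

    Here brackets of basis vectors are basis vectors up to sign, or 0, and the
    height j - i of B_ij is additive under the bracket. So Rc is diagonal, and
    for squared lengths w_a = beta lambda^(height a) all ratios of weights above
    equal lambda^h, with h the height of c. There are h - 1 ways to write B_c as
    a product of two of the B_a, and n - 1 - h of the B_a have a nonzero bracket
    with B_c; hence Rc(F_c, F_c) = lambda^h (h - n/2) ([ricci_geometric]). The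
    metrics of the theorem have beta = n t and lambda = t^(-2/n) / n, for which
    - 2 lambda^h (h - n/2) is the time derivative of beta lambda^h
    ([flow_weight_derive]).

    For the soliton equation, x^ij |-> q^(j-i) x^ij multiplies F_ij by q^(j-i)
    ([frame_mx_dilation]), because it is an automorphism of the group; its
    pullback rescales the squared length of F_ij by q^(2(j-i)), which for
    q = t^(-1/n) is the factor between t g(1) and g(t). *)

Set Implicit Arguments.
Unset Strict Implicit.
Unset Printing Implicit Defensive.

Import Order.TTheory GRing.Theory Num.Theory.
Import numFieldNormedType.Exports.

Local Open Scope classical_set_scope.
Local Open Scope ring_scope.

(** * Calculus of smooth functions and of matrix fields *)

Section SmoothFunctions.
Context {R : realType} {m : nat}.
Implicit Types (f h : 'rV[R]_m -> R) (i : 'I_m) (x : 'rV[R]_m).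

Lemma CkW k f : Ck k.+1 f -> Ck k f.
Proof.
elim: k f => [|k IHk] f [cf df]; first by split.
by split=> // i; have [dfi /IHk] := df i.
Qed.

Lemma smooth_derivable f i x : smooth f -> derivable f x (delta_mx 0 i).
Proof. by move=> /(_ 1%N) [_ /(_ i) []]. Qed.

Lemma smooth_partial f i : smooth f -> smooth (partial f i).
Proof. by move=> sf k; have [_ /(_ i) []] := sf k.+1. Qed.

Lemma Ck_continuous k f : Ck k f -> continuous f.
Proof. by case: k => [|k] []. Qed.

Lemma CkS_derivable k f i x : Ck k.+1 f -> derivable f x (delta_mx 0 i).
Proof. by case=> _ /(_ i) []. Qed.

Lemma CkS_partial k f i : Ck k.+1 f -> Ck k (partial f i).
Proof. by case=> _ /(_ i) []. Qed.

Lemma smooth_cst (c : R) : smooth (fun _ : 'rV[R]_m => c).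
Proof.
move=> k; elim: k c => [|k IHk] c.
  by split=> //; exact: cst_continuous.
split=> [|i]; first exact: cst_continuous.
split=> [x|]; first exact: derivable_cst.
have -> : partial (fun _ : 'rV[R]_m => c) i = fun=> 0.
  by apply/funext => x; exact: derive_cst.
exact: IHk.
Qed.

Lemma is_derive_coord j i x :
  is_derive x (delta_mx 0 i) (fun y : 'rV[R]_m => y 0 j) (i == j)%:R.
Proof.
have cvg_quot : (fun h : R => h^-1 *: ((h *: delta_mx 0 i + x : 'rV[R]_m) 0 j - x 0 j))
    @ 0^' --> ((i == j)%:R : R).
  apply: (@cvg_trans _ ((fun=> (i == j)%:R : R) @ (0 : R)^')); last exact: cvg_cst.
  apply: near_eq_cvg; near=> h.
  have h0 : h != 0 by near: h; exact: nbhs_dnbhs_neq.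
  by rewrite !mxE eqxx /= addrK eq_sym /GRing.scale /= mulrA mulVf ?mul1r.
by split; [apply/cvg_ex; eexists; exact: cvg_quot|exact/cvg_lim].
Unshelve. all: by end_near. Qed.

Lemma partial_coord i j : partial (fun y : 'rV[R]_m => y 0 j) i = fun=> (i == j)%:R.
Proof. by apply/funext => x; have [_] := is_derive_coord j i x. Qed.

Lemma smooth_coord j : smooth (fun x : 'rV[R]_m => x 0 j).
Proof.
case=> [|k]; first by split=> //; exact: coord_continuous.
split=> [|i]; first exact: coord_continuous.
split=> [x|].
  by have [] := is_derive_coord j i x.
by rewrite partial_coord; exact: smooth_cst.
Qed.

Let continuous_add f h : continuous f -> continuous h -> continuous (fun x => f x + h x).
Proof. by move=> cf ch x; exact: (cvgD (cf x) (ch x)). Qed.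

Let continuous_mul f h : continuous f -> continuous h -> continuous (fun x => f x * h x).
Proof. by move=> cf ch x; exact: (cvgM (cf x) (ch x)). Qed.

Let continuous_inv f : (forall x, f x != 0) -> continuous f -> continuous (fun x => (f x)^-1).
Proof. by move=> f0 cf x; exact: (cvgV (f0 x) (cf x)). Qed.

Lemma CkD k f h : Ck k f -> Ck k h -> Ck k (fun x => f x + h x).
Proof.
elim: k f h => [|k IHk] f h Cf Ch.
  by split=> //; exact: continuous_add (Ck_continuous Cf) (Ck_continuous Ch).
split=> [|i]; first exact: continuous_add (Ck_continuous Cf) (Ck_continuous Ch).
split=> [x|]; first by apply: derivableD; [exact: CkS_derivable Cf|exact: CkS_derivable Ch].
have -> : partial (fun x => f x + h x) i = fun x => partial f i x + partial h i x.
  by apply/funext => x; apply: deriveD; [exact: CkS_derivable Cf|exact: CkS_derivable Ch].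
by apply: IHk; exact: CkS_partial.
Qed.

Lemma CkM k f h : Ck k f -> Ck k h -> Ck k (fun x => f x * h x).
Proof.
elim: k f h => [|k IHk] f h Cf Ch.
  by split=> //; exact: continuous_mul (Ck_continuous Cf) (Ck_continuous Ch).
split=> [|i]; first exact: continuous_mul (Ck_continuous Cf) (Ck_continuous Ch).
split=> [x|]; first by apply: derivableM; [exact: CkS_derivable Cf|exact: CkS_derivable Ch].
have -> : partial (fun x => f x * h x) i =
    fun x => f x * partial h i x + h x * partial f i x.
  by apply/funext => x; apply: deriveM; [exact: CkS_derivable Cf|exact: CkS_derivable Ch].
by apply: CkD; apply: IHk; (exact: CkW || exact: CkS_partial).
Qed.

Lemma smoothD f h : smooth f -> smooth h -> smooth (fun x => f x + h x).
Proof. by move=> sf sh k; exact: CkD. Qed.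

Lemma smoothM f h : smooth f -> smooth h -> smooth (fun x => f x * h x).
Proof. by move=> sf sh k; exact: CkM. Qed.

Lemma smoothN f : smooth f -> smooth (fun x => - f x).
Proof.
move=> sf; rewrite (_ : (fun x => _) = fun x => -1 * f x); last first.
  by apply/funext => x; rewrite mulN1r.
by apply: smoothM => //; exact: smooth_cst.
Qed.

Lemma smooth_sum (I : Type) (r : seq I) (P : pred I) (F : I -> 'rV[R]_m -> R) :
  (forall j, smooth (F j)) -> smooth (fun x => \sum_(j <- r | P j) F j x).
Proof.
move=> sF; elim: r => [|a r IHr].
  by rewrite (_ : (fun x => _) = fun=> 0);
    [exact: smooth_cst|apply/funext => x; rewrite big_nil].
rewrite (_ : (fun x => _) =
    fun x => (if P a then F a x else 0) + \sum_(j <- r | P j) F j x); last first.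
  by apply/funext => x; rewrite big_cons; case: (P a); rewrite ?add0r.
by apply: smoothD => //; case: (P a) => //; exact: smooth_cst.
Qed.

Lemma smooth_prod (I : Type) (r : seq I) (P : pred I) (F : I -> 'rV[R]_m -> R) :
  (forall j, smooth (F j)) -> smooth (fun x => \prod_(j <- r | P j) F j x).
Proof.
move=> sF; elim: r => [|a r IHr].
  by rewrite (_ : (fun x => _) = fun=> 1);
    [exact: smooth_cst|apply/funext => x; rewrite big_nil].
rewrite (_ : (fun x => _) =
    fun x => (if P a then F a x else 1) * \prod_(j <- r | P j) F j x); last first.
  by apply/funext => x; rewrite big_cons; case: (P a); rewrite ?mul1r.
by apply: smoothM => //; case: (P a) => //; exact: smooth_cst.
Qed.

Lemma smoothV f : (forall x, f x != 0) -> smooth f -> smooth (fun x => (f x)^-1).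
Proof.
move=> f0 sf k; elim: k f f0 sf => [|k IHk] f f0 sf.
  by split=> //; exact: continuous_inv f0 (Ck_continuous (sf 0%N)).
split=> [|i]; first exact: continuous_inv f0 (Ck_continuous (sf 0%N)).
split=> [x|]; first by apply: derivableV => //; exact: smooth_derivable.
have -> : partial (fun x => (f x)^-1) i =
    fun x => - partial f i x * ((f x)^-1 * (f x)^-1).
  apply/funext => x; rewrite /partial [LHS]deriveV //; last exact: smooth_derivable.
  by rewrite /GRing.scale /= expr2 invfM !mulNr mulrC.
by apply: CkM; [exact/smoothN/smooth_partial|apply: CkM; exact: IHk].
Qed.

End SmoothFunctions.

Section MatrixFields.
Context {R : realType} {m : nat}.

Definition smooth_mx p q (A : 'rV[R]_m -> 'M[R]_(p, q)) : Prop :=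
  forall a b, smooth (fun x => A x a b).

Definition dmx p q (i : 'I_m) (A : 'rV[R]_m -> 'M[R]_(p, q)) x : 'M[R]_(p, q) :=
  \matrix_(a, b) partial (fun y => A y a b) i x.

Lemma smooth_cst_mx p q (A : 'M[R]_(p, q)) : smooth_mx (fun=> A).
Proof. by move=> a b; exact: smooth_cst. Qed.

Lemma smooth_dmx p q i (A : 'rV[R]_m -> 'M[R]_(p, q)) :
  smooth_mx A -> smooth_mx (dmx i A).
Proof.
move=> sA a b; rewrite (_ : (fun x => _) = partial (fun y => A y a b) i).
  exact: smooth_partial.
by apply/funext => x; rewrite mxE.
Qed.

Lemma smooth_addmx p q (A B : 'rV[R]_m -> 'M[R]_(p, q)) :
  smooth_mx A -> smooth_mx B -> smooth_mx (fun x => A x + B x).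
Proof.
move=> sA sB a b; rewrite (_ : (fun x => _) = fun x => A x a b + B x a b).
  exact: smoothD.
by apply/funext => x; rewrite mxE.
Qed.

Lemma smooth_oppmx p q (A : 'rV[R]_m -> 'M[R]_(p, q)) :
  smooth_mx A -> smooth_mx (fun x => - A x).
Proof.
move=> sA a b; rewrite (_ : (fun x => _) = fun x => - A x a b).
  exact: smoothN.
by apply/funext => x; rewrite mxE.
Qed.

Lemma smooth_mulmx p q r (A : 'rV[R]_m -> 'M[R]_(p, q)) (B : 'rV[R]_m -> 'M[R]_(q, r)) :
  smooth_mx A -> smooth_mx B -> smooth_mx (fun x => A x *m B x).
Proof.
move=> sA sB a b; rewrite (_ : (fun x => _) = fun x => \sum_j A x a j * B x j b).
  by apply: smooth_sum => j; exact: smoothM.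
by apply/funext => x; rewrite mxE.
Qed.

Lemma smooth_trmx p q (A : 'rV[R]_m -> 'M[R]_(p, q)) :
  smooth_mx A -> smooth_mx (fun x => (A x)^T).
Proof.
move=> sA a b; rewrite (_ : (fun x => _) = fun x => A x b a) //.
by apply/funext => x; rewrite mxE.
Qed.

Lemma smooth_det p (A : 'rV[R]_m -> 'M[R]_p) :
  smooth_mx A -> smooth (fun x => \det (A x)).
Proof.
move=> sA; apply: smooth_sum => s; apply: smoothM; first exact: smooth_cst.
by apply: smooth_prod => i; exact: sA.
Qed.

(** Cramer's rule writes the entries of the inverse as quotients of
    determinants, which are polynomial in the entries of the matrix. *)
Lemma smooth_invmx p (A : 'rV[R]_m -> 'M[R]_p) :
  (forall x, A x \in unitmx) -> smooth_mx A -> smooth_mx (fun x => invmx (A x)).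
Proof.
move=> uA sA a b; rewrite (_ : (fun x => _) = fun x => (\det (A x))^-1 *
    ((-1) ^+ (b + a) * \det (row' b (col' a (A x))))); last first.
  by apply/funext => x; rewrite /invmx uA !mxE.
apply: smoothM.
  by apply: smoothV; [move=> x; rewrite -unitfE -unitmxE|exact: smooth_det].
apply: smoothM; first exact: smooth_cst.
apply: smooth_det => c d; rewrite (_ : (fun x => _) = fun x => A x (lift b c) (lift a d)) //.
by apply/funext => x; rewrite !mxE.
Qed.

Lemma dmx_cst p q i (A : 'M[R]_(p, q)) x : dmx i (fun=> A) x = 0.
Proof. by apply/matrixP => a b; rewrite !mxE; exact: derive_cst. Qed.

Lemma dmxD p q i (A B : 'rV[R]_m -> 'M[R]_(p, q)) x : smooth_mx A -> smooth_mx B ->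
  dmx i (fun y => A y + B y) x = dmx i A x + dmx i B x.
Proof.
move=> sA sB; apply/matrixP => a b; rewrite !mxE.
rewrite (_ : (fun y => _) = (fun y => A y a b) + (fun y => B y a b)); last first.
  by apply/funext => y; rewrite mxE.
by apply: deriveD; exact: smooth_derivable.
Qed.

Lemma dmxN p q i (A : 'rV[R]_m -> 'M[R]_(p, q)) x : smooth_mx A ->
  dmx i (fun y => - A y) x = - dmx i A x.
Proof.
move=> sA; apply/matrixP => a b; rewrite !mxE.
rewrite (_ : (fun y => _) = - (fun y => A y a b)); last first.
  by apply/funext => y; rewrite mxE.
by apply: deriveN; exact: smooth_derivable.
Qed.

Lemma dmxT p q i (A : 'rV[R]_m -> 'M[R]_(p, q)) x :
  dmx i (fun y => (A y)^T) x = (dmx i A x)^T.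
Proof.
apply/matrixP => a b; rewrite !mxE; congr (partial _ _ _).
by apply/funext => y; rewrite mxE.
Qed.

Lemma dmxM p q r i (A : 'rV[R]_m -> 'M[R]_(p, q)) (B : 'rV[R]_m -> 'M[R]_(q, r)) x :
  smooth_mx A -> smooth_mx B ->
  dmx i (fun y => A y *m B y) x = dmx i A x *m B x + A x *m dmx i B x.
Proof.
move=> sA sB; apply/matrixP => a b; rewrite !mxE /partial.
rewrite (_ : (fun y => _) = \sum_j (fun y => A y a j * B y j b)); last first.
  by apply/funext => y; rewrite mxE fct_sumE.
rewrite derive_sum; last first.
  by move=> j; apply: derivableM; exact: smooth_derivable.
rewrite -big_split; apply: eq_bigr => j _.
rewrite [LHS]deriveM; [|exact: smooth_derivable..].
by rewrite !mxE addrC [X in X + _ = _]mulrC.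
Qed.

Lemma dmx_invmx p i (A : 'rV[R]_m -> 'M[R]_p) x :
  (forall y, A y \in unitmx) -> smooth_mx A ->
  dmx i (fun y => invmx (A y)) x = - (invmx (A x) *m dmx i A x *m invmx (A x)).
Proof.
move=> uA sA; have sV := smooth_invmx uA sA.
have := dmxM i x sV sA.
rewrite (_ : (fun y => _) = fun=> 1%:M); last by apply/funext => y; rewrite mulVmx.
rewrite dmx_cst => /esym/eqP; rewrite addr_eq0 => /eqP.
by move=> /(congr1 (mulmx^~ (invmx (A x)))); rewrite mulmxK // mulNmx.
Qed.

End MatrixFields.

(** * Levi-Civita connection and Ricci tensor in a frame *)

Section LeviCivita.
Context {R : realType} {m : nat}.
Implicit Types (g : 'rV[R]_m -> 'M[R]_m) (x : 'rV[R]_m).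

(** Koszul's computation: in the alternating sum of first derivatives of g,
    metric compatibility and the symmetry in i, j leave twice one lowered
    symbol. Christoffel symbols can thus be identified by guessing them. *)
Lemma christoffel_unique g x (Gam : 'I_m -> 'M[R]_m) :
  g x \in unitmx -> (g x)^T = g x ->
  (forall i j k, Gam i j k = Gam j i k) ->
  (forall i, dmx i g x = Gam i *m g x + g x *m (Gam i)^T) ->
  forall k i j, christoffel g k i j x = Gam i j k.
Proof.
move=> ug gT torsion metric k i j.
have dgE l p q : partial (fun y => g y p q) l x =
    (Gam l *m g x) p q + (Gam l *m g x) q p.
  have /matrixP/(_ p q) := metric l; rewrite [LHS]mxE => ->.
  by rewrite [LHS]mxE -{2}gT -trmx_mul [X in _ + X]mxE.
have lowT p q r : (Gam p *m g x) q r = (Gam q *m g x) p r.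
  by rewrite !mxE; apply: eq_bigr => s _; rewrite torsion.
rewrite /christoffel.
under eq_bigr => l _.
  rewrite !dgE (lowT l i j) (lowT l j i) (lowT j i l).
  rewrite (_ : _ - _ = 2 * (Gam i *m g x) j l); last by ring.
  rewrite mulrCA; over.
rewrite -mulr_sumr mulrA mulVf ?pnatr_eq0 // mul1r.
transitivity ((Gam i *m g x *m invmx (g x)) j k); last by rewrite mulmxK.
rewrite [RHS]mxE; apply: eq_bigr => l _; rewrite mulrC; congr (_ * _).
by rewrite -{1}gT -trmx_inv mxE.
Qed.

(** Row k of Gam_i holds the components of nabla_i d_k, so that composed
    derivatives multiply in reversed order. *)
Lemma riemann_matrix g (Gam : 'I_m -> 'rV[R]_m -> 'M[R]_m) :
  (forall k i j x, christoffel g k i j x = Gam i x j k) ->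
  forall i j k l x, riemann g i j k l x =
    (dmx i (Gam j) x - dmx j (Gam i) x +
     (Gam j x *m Gam i x - Gam i x *m Gam j x)) k l.
Proof.
move=> GamE i j k l x.
have {}GamE a b c : christoffel g c a b = fun y => Gam a y b c.
  by apply/funext => y.
rewrite /riemann sumrB !mxE !GamE; congr (_ + (_ - _));
  by apply: eq_bigr => p _; rewrite !GamE.
Qed.

End LeviCivita.

Section Frame.
Context {R : realType} {m : nat}.
Variables (E : 'rV[R]_m -> 'M[R]_m) (C : 'I_m -> 'I_m -> 'I_m -> R).
Hypothesis smoothE : smooth_mx E.
Hypothesis unitE : forall x, E x \in unitmx.
Hypothesis mixedE : forall i j x, dmx i (dmx j E) x = dmx j (dmx i E) x.
(* With F_b the vector field given by row b of E, [F_b, F_c] is the sum of the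
   C b c a F_a. *)
Hypothesis bracketE : forall x b c l,
  \sum_k (E x b k * dmx k E x c l - E x c k * dmx k E x b l) =
  \sum_a C b c a * E x a l.

Local Notation Th x := (invmx (E x)).
Local Notation Cmx a := (\matrix_(b, c) C b c a).

(** The coframe form of [bracketE], as the derivative of Th is - Th (d_i E) Th.
    For a fixed a, both sides are the antisymmetric part of one matrix,
    conjugated by Th. *)
Lemma maurer_cartan x i j a :
  (Th x *m dmx i E x *m Th x) j a - (Th x *m dmx j E x *m Th x) i a =
  (Th x *m Cmx a *m (Th x)^T) i j.
Proof.
pose K : 'M[R]_m := \matrix_(k, c) (dmx k E x *m Th x) c a.
have CE : Cmx a = E x *m K - (E x *m K)^T.
  apply/matrixP => b c; rewrite ![in RHS]mxE -sumrB.
  transitivity (\sum_l (\sum_d C b c d * E x d l) * Th x l a).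
    transitivity (\sum_d C b c d * (E x *m Th x) d a).
      rewrite mulmxV // (bigD1 a) //= !mxE eqxx mulr1 big1 ?addr0 // => d da.
      by rewrite mxE (negbTE da) mulr0.
    under eq_bigr => d _ do rewrite mxE mulr_sumr.
    rewrite exchange_big; apply: eq_bigr => l _; rewrite mulr_suml.
    by apply: eq_bigr => d _; rewrite mulrA.
  under eq_bigr => l _ do rewrite -bracketE mulr_suml.
  rewrite exchange_big; apply: eq_bigr => k _.
  rewrite ![K _ _]mxE ![(_ *m Th x) _ _]mxE !mulr_sumr -sumrB.
  by apply: eq_bigr => l _; rewrite mulrBl !mulrA.
have -> : Th x *m Cmx a *m (Th x)^T = K *m (Th x)^T - (K *m (Th x)^T)^T.
  rewrite CE mulmxBr mulmxBl !trmx_mul trmxK !mulmxA mulVmx // mul1mx.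
  by rewrite -[X in _ - X]mulmxA -trmx_mul mulVmx // trmx1 mulmx1.
have KE p q : (Th x *m dmx p E x *m Th x) q a = (K *m (Th x)^T) p q.
  by rewrite -mulmxA !mxE; apply: eq_bigr => c _; rewrite [K _ _]mxE !mxE mulrC.
by rewrite !KE [RHS]mxE [X in _ = _ + X]mxE [X in _ = _ - X]mxE.
Qed.

(* Row b of W a holds the frame components of nabla_(F_a) F_b. *)
Variables (W : 'I_m -> 'M[R]_m) (d : 'rV[R]_m).
Hypothesis torsionW : forall a b c, W a b c - W b a c = C a b c.
Hypothesis metricW : forall a, W a *m diag_mx d + diag_mx d *m (W a)^T = 0.
Hypothesis d_neq0 : forall a, d 0 a != 0.

(** The metric that makes the frame orthogonal, with squared lengths d. *)
Definition frame_metric x : 'M[R]_m := Th x *m diag_mx d *m (Th x)^T.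

(** The matrix of nabla_i in the frame: d_i is the combination of the F_a with
    coefficients Th x i a. *)
Definition conn i x : 'M[R]_m := \sum_a Th x i a *: W a.

(** The matrix of nabla_i in the coordinate frame, obtained from [conn] by the
    gauge transformation E. *)
Definition coord_conn i x : 'M[R]_m := Th x *m (conn i x *m E x - dmx i E x).

Lemma smooth_coframe : smooth_mx (fun x => Th x).
Proof. exact: smooth_invmx. Qed.

Lemma smooth_conn i : smooth_mx (conn i).
Proof.
move=> b c; rewrite (_ : (fun x => _) = fun x => \sum_a Th x i a * W a b c).
  by apply: smooth_sum => a; apply: smoothM; [exact: smooth_coframe|exact: smooth_cst].
by apply/funext => x; rewrite summxE; apply: eq_bigr => a _; rewrite mxE.
Qed.

Lemma smooth_coord_conn i : smooth_mx (coord_conn i).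
Proof.
apply: smooth_mulmx; first exact: smooth_coframe.
apply: smooth_addmx; first by apply: smooth_mulmx => //; exact: smooth_conn.
by apply: smooth_oppmx; exact: smooth_dmx.
Qed.

Lemma dmx_conn i j x : dmx i (conn j) x = - \sum_a (Th x *m dmx i E x *m Th x) j a *: W a.
Proof.
apply/matrixP => b c; rewrite mxE [RHS]mxE summxE -sumrN.
rewrite (_ : (fun y => _) = \sum_a (fun y => Th y j a * W a b c)); last first.
  by apply/funext => y; rewrite /conn summxE fct_sumE; apply: eq_bigr => a _; rewrite mxE.
have dTh a : derivable (fun y => Th y j a) x (delta_mx 0 i).
  by apply: smooth_derivable; exact: smooth_coframe.
rewrite /partial derive_sum; last first.
  by move=> a; apply: derivableM => //; exact: derivable_cst.
apply: eq_bigr => a _; rewrite [LHS]deriveMr // [X in _ = - X]mxE -mulNr mulrC.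
congr (_ * _).
by have /matrixP/(_ j a) := dmx_invmx i x unitE smoothE; rewrite !mxE.
Qed.

(** The failure of d_i (Th x j a) to be symmetric in i and j is cancelled by the
    torsion C of the constant connection W, by [maurer_cartan]. *)
Lemma coord_conn_torsion x i j k : coord_conn i x j k = coord_conn j x i k.
Proof.
have connT p q a : (Th x *m conn p x) q a =
    (Th x *m (\matrix_(b, c) W b c a) *m (Th x)^T) p q.
  transitivity (\sum_c Th x q c * \sum_b Th x p b * W b c a).
    rewrite mxE; apply: eq_bigr => c _; rewrite summxE; congr (_ * _).
    by apply: eq_bigr => b _; rewrite mxE.
  rewrite [RHS]mxE; apply: eq_bigr => c _; rewrite [X in _ = X * _]mxE mulrC.
  by rewrite [X in _ = _ * X]mxE; congr (_ * _); apply: eq_bigr => b _; rewrite !mxE.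
pose G p : 'M[R]_m := Th x *m conn p x - Th x *m dmx p E x *m Th x.
have gaugeE p : coord_conn p x = G p *m E x.
  by rewrite /coord_conn /G mulmxBr mulmxBl mulmxKV // mulmxA.
suff GT a : G i j a = G j i a.
  rewrite (gaugeE i) (gaugeE j) [LHS]mxE [RHS]mxE.
  by apply: eq_bigr => a _; congr (_ * _); exact: GT.
have subE (A B : 'M[R]_m) p q : (A - B) p q = A p q - B p q by rewrite !mxE.
rewrite [LHS]subE [RHS]subE; apply/eqP; rewrite -subr_eq0 opprD opprK addrACA.
rewrite (addrC (- _)) -[X in _ + X]opprB maurer_cartan !connT subr_eq0.
set U := \matrix_(b, c) W b c a; set V := Th x *m U *m _.
have -> : Cmx a = U - U^T by apply/matrixP => b c; rewrite !mxE torsionW.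
have -> : Th x *m (U - U^T) *m (Th x)^T = V - V^T.
  by rewrite mulmxBr mulmxBl !trmx_mul trmxK mulmxA.
by rewrite subE [X in _ == _ - X]mxE.
Qed.

Lemma frame_metric_unit x : frame_metric x \in unitmx.
Proof.
rewrite /frame_metric !unitmx_mul unitmx_tr unitmx_inv unitE andbT /=.
by rewrite unitmxE det_diag unitfE; apply/prodf_neq0 => a _.
Qed.

Lemma frame_metricT x : (frame_metric x)^T = frame_metric x.
Proof. by rewrite /frame_metric !trmx_mul trmxK tr_diag_mx mulmxA. Qed.

Lemma smooth_frame_metric : smooth_mx frame_metric.
Proof.
apply: smooth_mulmx; last exact/smooth_trmx/smooth_coframe.
by apply: smooth_mulmx; [exact: smooth_coframe|exact: smooth_cst_mx].
Qed.

Lemma coord_conn_metric i x : dmx i frame_metric x =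
  coord_conn i x *m frame_metric x + frame_metric x *m (coord_conn i x)^T.
Proof.
set X := conn i x *m diag_mx d.
have connW : X + X^T = 0.
  rewrite trmx_mul tr_diag_mx {}/X /conn raddf_sum mulmx_suml mulmx_sumr -big_split.
  rewrite big1 // => a _ /=.
  by rewrite linearZ -scalemxAl -scalemxAr -scalerDr metricW scaler0.
have half : coord_conn i x *m frame_metric x =
    dmx i (fun y => Th y) x *m diag_mx d *m (Th x)^T
    + Th x *m X *m (Th x)^T.
  rewrite dmx_invmx // /coord_conn /frame_metric !mulmxBr !mulmxBl !mulNmx !mulmxA.
  by rewrite mulmxK // addrC.
have -> : frame_metric x *m (coord_conn i x)^T = (coord_conn i x *m frame_metric x)^T.
  by rewrite [RHS]trmx_mul frame_metricT.
rewrite half raddfD /= addrACA; clearbody X; clear half.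
have -> : Th x *m X *m (Th x)^T + (Th x *m X *m (Th x)^T)^T = 0.
  by rewrite !trmx_mul trmxK !mulmxA -mulmxDl -mulmxDr connW mulmx0 mul0mx.
rewrite addr0 /= !trmx_mul trmxK tr_diag_mx mulmxA /frame_metric.
rewrite dmxM; [|apply: smooth_mulmx|exact/smooth_trmx/smooth_coframe]; first last.
- exact: smooth_cst_mx.
- exact: smooth_coframe.
rewrite dmxM; [|exact: smooth_coframe|exact: smooth_cst_mx].
by rewrite dmx_cst mulmx0 addr0 dmxT.
Qed.

Lemma frame_christoffel k i j x : christoffel frame_metric k i j x = coord_conn i x j k.
Proof.
apply: (christoffel_unique (Gam := fun i => coord_conn i x)).
- exact: frame_metric_unit.
- exact: frame_metricT.
- exact: coord_conn_torsion.
- by move=> l; exact: coord_conn_metric.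
Qed.

(** R(F_b, F_c) in the frame; the sum is the contribution of [F_b, F_c]. *)
Definition frame_curvature b c : 'M[R]_m :=
  W c *m W b - W b *m W c - \sum_a C b c a *: W a.

(** The derivatives of the coefficients of [conn] enter only through
    [maurer_cartan], which makes the curvature tensorial. *)
Lemma frame_curvatureE i j x :
  dmx i (conn j) x - dmx j (conn i) x + (conn j x *m conn i x - conn i x *m conn j x) =
  \sum_b \sum_c (Th x i b * Th x j c) *: frame_curvature b c.
Proof.
have bilin p q : conn p x *m conn q x =
    \sum_b \sum_c (Th x p b * Th x q c) *: (W b *m W c).
  rewrite /conn mulmx_suml; apply: eq_bigr => b _; rewrite mulmx_sumr.
  by apply: eq_bigr => c _; rewrite -scalemxAl -scalemxAr scalerA.
rewrite !bilin !dmx_conn opprK addrC.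
rewrite [X in X - _]exchange_big -sumrB.
have -> : - \sum_a (Th x *m dmx i E x *m Th x) j a *: W a +
    \sum_a (Th x *m dmx j E x *m Th x) i a *: W a =
    - \sum_b \sum_c (Th x i b * Th x j c) *: \sum_a C b c a *: W a.
  rewrite addrC -opprB -sumrB; congr (- _).
  under eq_bigr => a _ do rewrite -scalerBl maurer_cartan.
  transitivity (\sum_a \sum_b \sum_c (Th x i b * Th x j c * C b c a) *: W a).
    apply: eq_bigr => a _; rewrite mxE.
    under eq_bigr => c _ do rewrite mxE mulr_suml.
    rewrite exchange_big scaler_suml; apply: eq_bigr => b _; rewrite scaler_suml.
    by apply: eq_bigr => c _; rewrite !mxE; congr (_ *: _); rewrite -!mulrA (mulrC (Th x j c)).
  rewrite exchange_big; apply: eq_bigr => b _; rewrite exchange_big.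
  by apply: eq_bigr => c _; rewrite scaler_sumr; apply: eq_bigr => a _; rewrite scalerA.
rewrite -sumrB; apply: eq_bigr => b _; rewrite -!sumrB; apply: eq_bigr => c _.
by rewrite /frame_curvature !scalerBr (mulrC (Th x j c)).
Qed.

(** The gauge transformation conjugates the curvature; the second derivatives of
    E cancel in the antisymmetrization. *)
Lemma gauge_curvature i j x :
  dmx i (coord_conn j) x - dmx j (coord_conn i) x
    + (coord_conn j x *m coord_conn i x - coord_conn i x *m coord_conn j x) =
  Th x *m (dmx i (conn j) x - dmx j (conn i) x
    + (conn j x *m conn i x - conn i x *m conn j x)) *m E x.
Proof.
pose T p q : 'M[R]_m := dmx p (coord_conn q) x - coord_conn p x *m coord_conn q x.
have EG q y : E y *m coord_conn q y = conn q y *m E y - dmx q E y.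
  by rewrite /coord_conn mulKVmx.
have ET p q : E x *m T p q = dmx p (conn q) x *m E x + conn q x *m dmx p E x
    - dmx p (dmx q E) x - conn p x *m (conn q x *m E x) + conn p x *m dmx q E x.
  have : dmx p (fun y => E y *m coord_conn q y) x =
         dmx p (fun y => conn q y *m E y + - dmx q E y) x.
    by congr (dmx p _ x); apply/funext => y; exact: EG.
  rewrite dmxM //; last exact: smooth_coord_conn.
  rewrite dmxD; [|by apply: smooth_mulmx => //; exact: smooth_conn
                 |by apply: smooth_oppmx; exact: smooth_dmx].
  rewrite dmxM //; last exact: smooth_conn.
  rewrite dmxN; last exact: smooth_dmx.
  rewrite addrC => /esym/eqP; rewrite -subr_eq => /eqP EdG.
  rewrite /T mulmxBr -{}EdG [X in _ - X]mulmxA EG mulmxBl -mulmxA EG mulmxBr.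
  set A := dmx p (conn q) x *m _; set B := conn q x *m _.
  set F := dmx p (dmx q E) x; set H := dmx p E x *m _.
  set P := conn p x *m (conn q x *m _); set Q := conn p x *m _.
  clearbody A B F H P Q.
  by apply/matrixP => a b; rewrite !mxE; ring.
transitivity (T i j - T j i).
  by rewrite /T opprB addrACA [RHS]addrACA [X in _ = _ + X]addrC.
rewrite -[LHS](mulKmx (unitE x)) -[RHS]mulmxA; congr (_ *m _).
clearbody T; rewrite mulmxBr (ET i j) (ET j i) mixedE mulmxDl mulmxBl mulmxBl.
rewrite -(mulmxA (conn j x)) -(mulmxA (conn i x)).
set A := dmx i (conn j) x *m _; set B := dmx j (conn i) x *m _.
set P := conn i x *m (conn j x *m _); set Q := conn j x *m (conn i x *m _).
set U := conn j x *m _; set V := conn i x *m _; set Z := dmx j _ _.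
clearbody A B P Q U V Z.
by apply/matrixP => a b; rewrite !mxE; ring.
Qed.

(** The Ricci tensor is the contraction of a tensor, so that the coordinate
    derivatives in its definition give way to algebra in the structure
    constants. *)
Theorem ricci_frame x : ricci frame_metric x =
  Th x *m (\matrix_(c, e) \sum_b frame_curvature b c e b) *m (Th x)^T.
Proof.
apply/matrixP => j k; rewrite [LHS]mxE.
under eq_bigr => i _.
  rewrite (riemann_matrix frame_christoffel) gauge_curvature frame_curvatureE.
  rewrite mulmx_sumr mulmx_suml summxE.
  under eq_bigr => b _.
    rewrite mulmx_sumr mulmx_suml summxE.
    under eq_bigr => c _ do rewrite -scalemxAr -scalemxAl mxE.
    over.
  over.
rewrite exchange_big /=.
transitivity (\sum_b \sum_c Th x j c * (Th x *m frame_curvature b c) k b).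
  apply: eq_bigr => b _; rewrite exchange_big; apply: eq_bigr => c _.
  rewrite -[in RHS](mulmxK (unitE x) (Th x *m frame_curvature b c)).
  rewrite [X in _ = _ * X]mxE mulr_sumr; apply: eq_bigr => i _; ring.
rewrite exchange_big [RHS]mxE.
transitivity (\sum_c \sum_e Th x j c * (Th x k e * \sum_b frame_curvature b c e b)).
  apply: eq_bigr => c _; rewrite -!mulr_sumr; congr (_ * _).
  under eq_bigr => b _ do rewrite mxE.
  by rewrite exchange_big; apply: eq_bigr => e _; rewrite mulr_sumr.
rewrite exchange_big; apply: eq_bigr => e _; rewrite mxE mulr_suml.
by apply: eq_bigr => c _; rewrite !mxE -mulrA (mulrC (Th x k e)).
Qed.

End Frame.

(** * Ricci curvature of a diagonal left-invariant metric *)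

Section Koszul.
Context {R : realType} {m : nat}.
Variables (C : 'I_m -> 'I_m -> 'I_m -> R) (w : 'rV[R]_m).
Hypothesis C_anti : forall a b c, C a b c = - C b a c.
Hypothesis w_neq0 : forall a, w 0 a != 0.

(** Koszul's formula for the frame components of nabla_(F_a) F_b, when w holds
    the squared lengths: C a b c * w 0 c is the product of [F_a, F_b] and F_c. *)
Definition koszul (a : 'I_m) : 'M[R]_m := \matrix_(b, c)
  (2^-1 * (C a b c * w 0 c - C b c a * w 0 a + C c a b * w 0 b) / w 0 c).

Lemma koszul_torsion a b c : koszul a b c - koszul b a c = C a b c.
Proof.
rewrite !mxE (C_anti b a) (C_anti c b) (C_anti c a).
by have := w_neq0 c; move: (w 0 c) => z z0; field.
Qed.

Lemma koszul_metric a : koszul a *m diag_mx w + diag_mx w *m (koszul a)^T = 0.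
Proof.
apply/matrixP => b c; rewrite mul_mx_diag mul_diag_mx !mxE.
rewrite (C_anti c a) (C_anti c b) (C_anti b a).
by have := w_neq0 b; have := w_neq0 c; move: (w 0 b) (w 0 c) => y z z0 y0; field; rewrite y0.
Qed.

Hypothesis unimodular : forall a, \sum_b C a b b = 0.
Hypothesis killing0 : forall a b, \sum_c \sum_e C a c e * C b e c = 0.

Lemma koszul_trace a : \sum_b koszul b a b = 0.
Proof.
transitivity (- \sum_b C a b b); last by rewrite unimodular oppr0.
rewrite -sumrN; apply: eq_bigr => b _.
have Cbb : C b b a = 0.
  by apply/eqP; rewrite -[_ == 0](@mulrn_eq0 _ _ 2) mulr2n {1}C_anti addNr.
rewrite mxE Cbb (C_anti b a); have := w_neq0 b.
by move: (w 0 b) => z z0; field.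
Qed.

(** Summing over a pair of frame indices makes only the part symmetric under
    their exchange matter. The terms of the curvature then reduce to lengths of
    brackets and to the Killing form, which vanishes for a nilpotent algebra. *)
Lemma ricci_koszul c d : \sum_b frame_curvature C koszul b c d b =
  \sum_b \sum_e (4^-1 * C b e c * C b e d * w 0 c * w 0 d / (w 0 b * w 0 e)
                 - 2^-1 * C c b e * C d b e * w 0 e / w 0 b).
Proof.
pose F b e := - (koszul b d e * koszul c e b) - C b c e * koszul e d b.
transitivity (\sum_b \sum_e F b e).
  have tr0 : \sum_b (koszul c *m koszul b) d b = 0.
    under eq_bigr => b _ do rewrite mxE.
    rewrite exchange_big big1 // => e _ /=.
    by rewrite -mulr_sumr koszul_trace mulr0.
  rewrite -[RHS]add0r -[X in _ = X + _]tr0 -big_split; apply: eq_bigr => b _ /=.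
  rewrite /frame_curvature [LHS]mxE [X in X + _ = _]mxE [X in _ + X + _ = _]mxE.
  rewrite [X in _ + X = _]mxE summxE -addrA; congr (_ + _).
  rewrite mxE -!sumrN -big_split; apply: eq_bigr => e _ /=.
  by rewrite [X in _ + - X]mxE.
pose G b e := 4^-1 * C b e c * C b e d * w 0 c * w 0 d / (w 0 b * w 0 e)
  - 2^-1 * C c b e * C d b e * w 0 e / w 0 b.
(* The summand of the Killing form. *)
pose K b e := - 2^-1 * (C c b e * C d e b).
have symm (f : 'I_m -> 'I_m -> R) :
      \sum_b \sum_e (f b e + f e b) = 2 * \sum_b \sum_e f b e.
  under eq_bigr => b _ do rewrite big_split.
  by rewrite big_split /= [X in _ + X]exchange_big mulr_natl mulr2n.
have FG b e : F b e + F e b = (G b e + K b e) + (G e b + K e b).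
  rewrite /F /G /K !mxE.
  rewrite !(C_anti b c) !(C_anti e c) !(C_anti b d) !(C_anti e d) !(C_anti e b).
  have := w_neq0 b; have := w_neq0 e.
  move: (w 0 b) (w 0 e) (w 0 c) (w 0 d) => y z u v z0 y0.
  by field; rewrite z0.
have n2 : (2 : R) != 0 by rewrite pnatr_eq0.
apply: (mulfI n2); rewrite -symm.
under eq_bigr => b _ do under eq_bigr => e _ do rewrite FG.
rewrite (symm (fun b e => G b e + K b e)); congr (_ * _).
under eq_bigr => b _ do rewrite big_split.
rewrite big_split /= [X in _ + X](_ : _ = 0) ?addr0 // /K.
under eq_bigr => b _ do rewrite -mulr_sumr.
by rewrite -mulr_sumr killing0 mulr0.
Qed.

End Koszul.

(** * The left-invariant frame of the unitriangular group *)

Section Indices.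
Context {n : nat}.

Definition height (a : 'I_(dimUT n)) : nat := (pcol a - prow a)%N.

(** The matrix product B_a B_b is B_c when this holds, and 0 when it holds for
    no c. *)
Definition composes (a b c : 'I_(dimUT n)) : bool :=
  [&& pcol a == prow b, prow c == prow a & pcol c == pcol b].

Lemma height_gt0 a : (0 < height a)%N.
Proof. by rewrite subn_gt0; exact: prow_lt_pcol. Qed.

Lemma composes_height a b c : composes a b c -> height c = (height a + height b)%N.
Proof.
case/and3P => /eqP ab /eqP ca /eqP cb; rewrite /height ca cb.
have := prow_lt_pcol a; have := prow_lt_pcol b; rewrite -ab => h1 h2.
by rewrite addnC addnBA ?subnK // ltnW.
Qed.

Lemma composes_asym a b c e : composes a b c -> composes b a e -> False.
Proof.
case/and3P => /eqP ab _ _ /and3P[/eqP ba _ _].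
have := prow_lt_pcol a; have := prow_lt_pcol b; rewrite ab ba => h1 h2.
by have := ltn_trans h1 h2; rewrite ltnn.
Qed.

Lemma composes_inj a b c e : composes a b c -> composes a b e -> c = e.
Proof.
case/and3P => _ /eqP ca /eqP cb /and3P[_ /eqP ea /eqP eb].
by apply: pos_inj; rewrite ?ca ?cb ?ea ?eb.
Qed.

Lemma composes_injl a b c e : composes a b c -> composes e b c -> a = e.
Proof.
case/and3P => /eqP ab /eqP ca _ /and3P[/eqP eb /eqP ce _].
by apply: pos_inj; rewrite -?ca -?ce ?ab ?eb.
Qed.

Lemma composes_injr a b c e : composes a b c -> composes a e c -> b = e.
Proof.
case/and3P => /eqP ab _ /eqP cb /and3P[/eqP ae _ /eqP ce].
by apply: pos_inj; rewrite -?cb -?ce -?ab -?ae.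
Qed.

Lemma sum_pos (V : nmodType) (G : 'I_n -> 'I_n -> V) :
  \sum_a G (prow a) (pcol a) = \sum_(p < n) \sum_(q < n | (p < q)%N) G p q.
Proof.
rewrite (partition_big (fun a => prow a) xpredT) //; apply: eq_bigr => p _.
rewrite (partition_big (fun a => pcol a) (fun q : 'I_n => (p < q)%N)) => [|a /eqP <-];
  last exact: prow_lt_pcol.
apply: eq_bigr => q pq.
have [a [pa qa]] := pos_surj pq.
rewrite (big_pred1 a) ?pa ?qa // => b; apply/andP/eqP => [[/eqP pb /eqP qb]|-> /=].
  by apply: pos_inj; rewrite ?pb ?qb ?pa ?qa.
by rewrite pa qa.
Qed.

Lemma sum_pos_delta (R : pzRingType) (G : 'I_n -> 'I_n -> R) (p q : 'I_n) :
  \sum_a ((prow a == p) && (pcol a == q))%:R * G (prow a) (pcol a) =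
  (p < q)%N%:R * G p q.
Proof.
case: (boolP (p < q)%N) => pq.
  have [a [pa qa]] := pos_surj pq.
  rewrite (bigD1 a) //= pa qa !eqxx big1 ?addr0 // => b ba.
  case: andP => [[/eqP pb /eqP qb]|_]; last by rewrite mul0r.
  by case/eqP: ba; apply: pos_inj; rewrite ?pb ?qb ?pa ?qa.
rewrite mul0r big1 // => a _; case: andP => [[/eqP pa /eqP qa]|_]; last by rewrite mul0r.
by move: pq; rewrite -pa -qa prow_lt_pcol.
Qed.

Lemma sum_prow (V : nmodType) (p : 'I_n) (F : 'I_n -> V) :
  \sum_(a | prow a == p) F (pcol a) = \sum_(q < n | (p < q)%N) F q.
Proof.
rewrite big_mkcond (sum_pos (fun p' q => if p' == p then F q else 0)).
rewrite (bigD1 p) //= eqxx [X in _ + X]big1 ?addr0 // => p' /negbTE p'p.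
by rewrite big1 // => q _; rewrite p'p.
Qed.

Lemma sum_pcol (V : nmodType) (q : 'I_n) (F : 'I_n -> V) :
  \sum_(a | pcol a == q) F (prow a) = \sum_(p < n | (p < q)%N) F p.
Proof.
rewrite big_mkcond (sum_pos (fun p q' => if q' == q then F p else 0)).
rewrite [RHS]big_mkcond; apply: eq_bigr => p _.
case: ifP => pq; first rewrite (bigD1 q) //= eqxx big1 ?addr0 //.
  by move=> q' /andP[_ /negbTE ->].
by rewrite big1 // => q' pq'; case: eqP => // e; rewrite e pq in pq'.
Qed.

End Indices.

Section LeftInvariantFrame.
Context {R : realType} {n : nat}.
Implicit Types (x y : 'rV[R]_(dimUT n)).

Definition structure_const (a b c : 'I_(dimUT n)) : R :=
  (composes a b c)%:R - (composes b a c)%:R.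

Lemma UTmx_diag x p : UTmx x p p = 1.
Proof. by have [-> _] := UTmx_unitriangular x. Qed.

Lemma UTmx_lower x (p q : 'I_n) : (q < p)%N -> UTmx x p q = 0.
Proof. by have [_] := UTmx_unitriangular x; apply. Qed.

Lemma UTmx_upper x a : UTmx x (prow a) (pcol a) = x 0 a.
Proof. by have /rowP/(_ a) := UTmxK x; rewrite mxE. Qed.

Lemma UTmxE x p q : UTmx x p q =
  (p == q)%:R + \sum_a x 0 a * ((p == prow a) && (q == pcol a))%:R.
Proof.
rewrite /UTmx !mxE summxE; congr (_ + _).
by apply: eq_bigr => a _; rewrite !mxE.
Qed.

Lemma sum_delta_mx (v : 'rV[R]_(dimUT n)) b :
  (\sum_a v 0 a *: delta_mx (prow a) (pcol a) : 'M[R]_n) (prow b) (pcol b) = v 0 b.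
Proof.
rewrite -(UTmx_upper v b) UTmxE summxE (_ : (_ == _) = false) ?add0r.
  by apply: eq_bigr => a _; rewrite !mxE.
by apply/negbTE; rewrite neq_ltn prow_lt_pcol.
Qed.

Lemma mulmx_delta (A : 'M[R]_n) (i j p q : 'I_n) :
  (A *m delta_mx i j) p q = A p i * (q == j)%:R.
Proof.
rewrite mxE (bigD1 i) //= mxE eqxx big1 ?addr0 // => k ki.
by rewrite mxE (negbTE ki) mulr0.
Qed.

(** F_a is x B_a as a matrix, hence has nonzero entries in one column only. *)
Lemma frame_mxE x a b :
  frame_mx x a b = UTmx x (prow b) (prow a) * (pcol b == pcol a)%:R.
Proof. by rewrite mxE -mulmx_delta -frameE sum_delta_mx. Qed.

Lemma smooth_UTmx : smooth_mx (@UTmx R n).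
Proof.
move=> p q; rewrite (_ : (fun x => _) = fun x => (p == q)%:R +
    \sum_a x 0 a * ((p == prow a) && (q == pcol a))%:R); last first.
  by apply/funext => x; exact: UTmxE.
apply: smoothD; first exact: smooth_cst.
by apply: smooth_sum => a; apply: smoothM; [exact: smooth_coord|exact: smooth_cst].
Qed.

Lemma dmx_UTmx a x : dmx a (@UTmx R n) x = delta_mx (prow a) (pcol a).
Proof.
apply/matrixP => p q; rewrite mxE.
rewrite (_ : (fun y => _) = cst (p == q)%:R + \sum_b
    (fun y : 'rV[R]_(dimUT n) => y 0 b * ((p == prow b) && (q == pcol b))%:R)); last first.
  by apply/funext => y; rewrite UTmxE /= fct_sumE.
have dyb b : derivable (fun y : 'rV[R]_(dimUT n) => y 0 b) x (delta_mx 0 a).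
  by apply: smooth_derivable; exact: smooth_coord.
have dybc b : derivable (fun y : 'rV[R]_(dimUT n) =>
    y 0 b * ((p == prow b) && (q == pcol b))%:R) x (delta_mx 0 a).
  by apply: derivableM => //; exact: derivable_cst.
rewrite /partial deriveD; [|exact: derivable_cst|exact: derivable_sum].
rewrite derive_cst add0r derive_sum // (bigD1 a) //= big1 ?addr0; last first.
  move=> b ba; rewrite deriveMr // -/(partial _ _ _) partial_coord [a == b]eq_sym (negbTE ba).
  by rewrite /GRing.scale /= mulr0.
by rewrite deriveMr // -/(partial _ _ _) partial_coord eqxx /GRing.scale /= mulr1 mxE.
Qed.

Lemma smooth_frame_mx : smooth_mx (@frame_mx R n).
Proof.
move=> a b; rewrite (_ : (fun x => _) =
    fun x => UTmx x (prow b) (prow a) * (pcol b == pcol a)%:R); last first.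
  by apply/funext => x; exact: frame_mxE.
by apply: smoothM; [exact: smooth_UTmx|exact: smooth_cst].
Qed.

(** The frame is affine in x: the derivative of x B_a along d_k is B_k B_a. *)
Lemma dmx_frame_mx k x :
  dmx k (@frame_mx R n) x = \matrix_(a, b) (composes k a b)%:R.
Proof.
apply/matrixP => a b; rewrite !mxE.
rewrite (_ : (fun y => _) =
    fun y => UTmx y (prow b) (prow a) * (pcol b == pcol a)%:R); last first.
  by apply/funext => y; exact: frame_mxE.
rewrite /partial deriveMr; last by apply: smooth_derivable; exact: smooth_UTmx.
have /matrixP/(_ (prow b) (prow a)) := dmx_UTmx k x; rewrite mxE /partial => ->.
rewrite mxE /GRing.scale /= -natrM mulnb /composes; congr (_%:R : R).
by rewrite andbC -andbA [in RHS]eq_sym andbCA.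
Qed.

Lemma frame_mx_mixed i j x :
  dmx i (dmx j (@frame_mx R n)) x = dmx j (dmx i (@frame_mx R n)) x.
Proof.
have cstE k : dmx k (@frame_mx R n) = fun=> \matrix_(a, b) (composes k a b)%:R.
  by apply/funext => y; exact: dmx_frame_mx.
by rewrite !cstE !dmx_cst.
Qed.

(** Both sides are the coordinate l of x B_b B_c: associativity of the matrix
    product is what makes the fields x B_b close under the bracket. *)
Lemma frame_mx_assoc x b c l :
  \sum_k frame_mx x b k * (composes k c l)%:R =
  \sum_a (composes b c a)%:R * frame_mx x a l.
Proof.
transitivity ((pcol b == prow c)%:R * (pcol l == pcol c)%:R * UTmx x (prow l) (prow b)).
  transitivity (\sum_k ((prow k == prow l) && (pcol k == prow c))%:R *
     (UTmx x (prow k) (prow b) * (pcol k == pcol b)%:R * (pcol l == pcol c)%:R)).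
    apply: eq_bigr => k _; rewrite frame_mxE /composes (eq_sym (prow l)).
    by case: (pcol k == prow c); case: (prow k == prow l); case: (pcol l == pcol c);
      rewrite ?mulr0 ?mul0r ?mulr1 ?mul1r.
  rewrite (sum_pos_delta (fun p q =>
    UTmx x p (prow b) * (q == pcol b)%:R * (pcol l == pcol c)%:R)).
  rewrite [prow c == _]eq_sym; case: eqP => [e|_]; last by rewrite !(mulr0, mul0r).
  case: ltnP => [_|le]; first by rewrite !mul1r mulr1 mulrC.
  by rewrite mul0r UTmx_lower ?mulr0 // (leq_trans _ le) // -e prow_lt_pcol.
transitivity (\sum_a ((prow a == prow b) && (pcol a == pcol c))%:R *
    ((pcol b == prow c)%:R * UTmx x (prow l) (prow a) * (pcol l == pcol a)%:R)).
  rewrite (sum_pos_delta (fun p q =>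
    (pcol b == prow c)%:R * UTmx x (prow l) p * (pcol l == q)%:R)).
  case: eqP => [e|]; last by rewrite !(mulr0, mul0r).
  by rewrite (ltn_trans (prow_lt_pcol b)) ?e ?prow_lt_pcol // !mul1r mulrC.
apply: eq_bigr => a _; rewrite frame_mxE /composes.
by case: (pcol b == prow c); case: (prow a == prow b); case: (pcol a == pcol c);
  rewrite ?mulr0 ?mul0r ?mulr1 ?mul1r ?mul0r.
Qed.

Lemma frame_mx_bracket x b c l :
  \sum_k (frame_mx x b k * dmx k (@frame_mx R n) x c l
          - frame_mx x c k * dmx k (@frame_mx R n) x b l) =
  \sum_a structure_const b c a * frame_mx x a l.
Proof.
rewrite sumrB; under eq_bigr => k _ do rewrite dmx_frame_mx [X in _ * X]mxE.
under [X in _ - X]eq_bigr => k _ do rewrite dmx_frame_mx [X in _ * X]mxE.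
rewrite !frame_mx_assoc -sumrB; apply: eq_bigr => a _.
by rewrite /structure_const mulrBl.
Qed.

Lemma structure_const_anti a b c : structure_const a b c = - structure_const b a c.
Proof. by rewrite /structure_const opprB. Qed.

Lemma structure_const_height a b c : structure_const a b c != 0 ->
  height c = (height a + height b)%N.
Proof.
rewrite /structure_const; case: (boolP (composes a b c)) => [/composes_height -> //|_].
case: (boolP (composes b a c)) => [/composes_height -> _|_]; first exact: addnC.
by rewrite subrr eqxx.
Qed.

Lemma structure_const_unimodular a : \sum_b structure_const a b b = 0.
Proof.
rewrite big1 // => b _; apply/eqP; apply/negPn/negP => /structure_const_height.
by have := height_gt0 a; lia.
Qed.

(** Nilpotency: taking brackets strictly increases the height. *)
Lemma structure_const_killing a b :
  \sum_c \sum_e structure_const a c e * structure_const b e c = 0.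
Proof.
rewrite big1 // => c _; rewrite big1 // => e _; apply/eqP/negPn/negP.
rewrite mulf_eq0 negb_or => /andP[/structure_const_height h1 /structure_const_height h2].
by have := height_gt0 a; lia.
Qed.

End LeftInvariantFrame.

(** * Ricci curvature of metrics that scale geometrically with the height *)

Section GeometricMetric.
Context {R : realType} {n : nat}.
Implicit Types (a b c e : 'I_(dimUT n)).
Notation C := (@structure_const R n).

Lemma sum_interval i j k :
  \sum_(q < k) (i <= q < j)%:R = (minn j k - i)%:R :> R.
Proof.
rewrite -natr_sum; congr (_%:R); elim: k => [|k IHk]; first by rewrite big_ord0 minn0.
by rewrite big_ord_recr /= IHk; lia.
Qed.

(** B_c factors as B_a B_b once for each index strictly between its row and its
    column. *)
Lemma count_factorizations c :
  \sum_a \sum_b (composes a b c)%:R = (height c)%:R - 1 :> R.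
Proof.
transitivity (\sum_(a | prow a == prow c) (pcol a < pcol c)%N%:R : R).
  rewrite [RHS]big_mkcond; apply: eq_bigr => a _.
  transitivity (\sum_b ((prow b == pcol a) && (pcol b == pcol c))%:R
      * (prow c == prow a)%:R : R).
    apply: eq_bigr => b _; rewrite -natrM mulnb; congr (_%:R).
    rewrite /composes [pcol a == _]eq_sym [pcol c == _]eq_sym.
    by case: (prow b == _); case: (pcol b == _); case: (prow c == _).
  rewrite (sum_pos_delta (fun _ _ => (prow c == prow a)%:R)) eq_sym.
  by case: eqP; rewrite ?mulr1 ?mulr0.
rewrite (sum_prow _ (fun q => (q < pcol c)%N%:R)) big_mkcond.
transitivity (\sum_(q < n) (prow c < q < pcol c)%:R : R).
  by apply: eq_bigr => q _; case: ifP.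
rewrite sum_interval (minn_idPl (ltnW (ltn_ord _))) subnS -subn1 natrB //.
exact: height_gt0.
Qed.

(** B_c B_a is nonzero once for each column to the right of that of c. *)
Lemma count_right_multiples c :
  \sum_a \sum_b (composes c a b)%:R = (n - (pcol c).+1)%:R :> R.
Proof.
transitivity (\sum_(a | prow a == pcol c) (prow c < pcol a)%N%:R : R).
  rewrite [RHS]big_mkcond; apply: eq_bigr => a _.
  transitivity (\sum_b ((prow b == prow c) && (pcol b == pcol a))%:R
      * (pcol c == prow a)%:R : R).
    by apply: eq_bigr => b _; rewrite -natrM mulnb andbC.
  rewrite (sum_pos_delta (fun _ _ => (pcol c == prow a)%:R)) eq_sym.
  by case: eqP; rewrite ?mulr1 ?mulr0.
rewrite (sum_prow _ (fun q => (prow c < q)%N%:R)) big_mkcond.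
transitivity (\sum_(q < n) ((pcol c).+1 <= q < n)%:R : R).
  apply: eq_bigr => q _; rewrite ltn_ord andbT; case: ifP => // cq.
  by rewrite (ltn_trans (prow_lt_pcol c)).
by rewrite sum_interval minnn.
Qed.

(** B_a B_c is nonzero once for each row above that of c. *)
Lemma count_left_multiples c :
  \sum_a \sum_b (composes a c b)%:R = (prow c)%:R :> R.
Proof.
transitivity (\sum_(a | pcol a == prow c) (prow a < pcol c)%N%:R : R).
  rewrite [RHS]big_mkcond; apply: eq_bigr => a _.
  transitivity (\sum_b ((prow b == prow a) && (pcol b == pcol c))%:R
      * (pcol a == prow c)%:R : R).
    by apply: eq_bigr => b _; rewrite -natrM mulnb andbC.
  rewrite (sum_pos_delta (fun _ _ => (pcol a == prow c)%:R)).
  by case: eqP; rewrite ?mulr1 ?mulr0.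
rewrite (sum_pcol _ (fun p => (p < pcol c)%N%:R)) big_mkcond.
transitivity (\sum_(p < n) (0 <= p < prow c)%:R : R).
  apply: eq_bigr => p _; rewrite leq0n /=; case: ifP => // pc.
  by rewrite (ltn_trans pc (prow_lt_pcol c)).
by rewrite sum_interval (minn_idPl (ltnW (ltn_ord _))) subn0.
Qed.

(** A bracket of two basis vectors is, up to sign, a basis vector or 0. *)
Lemma structure_const_mul_out b e c d : C b e c * C b e d =
  (c == d)%:R * ((composes b e c)%:R + (composes e b c)%:R).
Proof.
rewrite /structure_const.
case: (boolP (composes b e c)) => h1; case: (boolP (composes e b c)) => h2;
  try by case: (composes_asym h1 h2).
- case: (boolP (composes e b d)) => h4; first by case: (composes_asym h1 h4).
  case: (boolP (composes b e d)) => h3.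
    by rewrite (composes_inj h1 h3) eqxx /= mulr0n mulr1n; ring.
  case: eqP => [cd|_]; last by rewrite /= mulr0n; ring.
  by rewrite -cd h1 in h3.
- case: (boolP (composes b e d)) => h4; first by case: (composes_asym h2 h4).
  case: (boolP (composes e b d)) => h3.
    by rewrite (composes_inj h2 h3) eqxx /= mulr0n mulr1n; ring.
  case: eqP => [cd|_]; last by rewrite /= mulr0n; ring.
  by rewrite -cd h2 in h3.
- by rewrite /= !mulr0n; ring.
Qed.

Lemma composes_leftright a b c e : composes a b e -> composes b c e -> False.
Proof.
case/and3P => /eqP ab /eqP ea _ /and3P[_ /eqP eb _].
by have := prow_lt_pcol a; rewrite ab -ea eb ltnn.
Qed.

(** A basis vector is determined by its bracket with a given one. *)
Lemma structure_const_mul_in b e c d : C c b e * C d b e =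
  (c == d)%:R * ((composes c b e)%:R + (composes b c e)%:R).
Proof.
rewrite /structure_const.
case: (boolP (composes c b e)) => h1; case: (boolP (composes b c e)) => h2;
  try by case: (composes_leftright h1 h2).
- case: (boolP (composes b d e)) => h4; first by case: (composes_leftright h1 h4).
  case: (boolP (composes d b e)) => h3.
    by rewrite (composes_injl h1 h3) eqxx /= mulr0n mulr1n; ring.
  case: eqP => [cd|_]; last by rewrite /= mulr0n; ring.
  by rewrite -cd h1 in h3.
- case: (boolP (composes d b e)) => h4; first by case: (composes_leftright h4 h2).
  case: (boolP (composes b d e)) => h3.
    by rewrite (composes_injr h2 h3) eqxx /= mulr0n mulr1n; ring.
  case: eqP => [cd|_]; last by rewrite /= mulr0n; ring.
  by rewrite -cd h2 in h3.
- by rewrite /= !mulr0n; ring.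
Qed.

Variables beta lambda : R.
Hypothesis beta_neq0 : beta != 0.
Hypothesis lambda_neq0 : lambda != 0.

Definition geometric_weight : 'rV[R]_(dimUT n) := \row_a (beta * lambda ^+ height a).

Lemma geometric_weight_neq0 a : geometric_weight 0 a != 0.
Proof. by rewrite mxE mulf_neq0 // expf_neq0. Qed.

Lemma geometric_weight_composes a b c : composes a b c ->
  geometric_weight 0 c = geometric_weight 0 a * geometric_weight 0 b / beta.
Proof.
by move=> /composes_height h; rewrite !mxE h exprD; field.
Qed.

Let w := geometric_weight.

Lemma weight_out b e c :
  ((composes b e c)%:R + (composes e b c)%:R) * (w 0 c * w 0 c / (w 0 b * w 0 e)) =
  ((composes b e c)%:R + (composes e b c)%:R) * lambda ^+ height c.
Proof.
have key : composes b e c || composes e b c ->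
    w 0 c * w 0 c / (w 0 b * w 0 e) = lambda ^+ height c.
  move=> h; have wc : w 0 c = w 0 b * w 0 e / beta.
    by case/orP: h => /geometric_weight_composes -> //; rewrite [X in X / _ = _]mulrC.
  rewrite {1}wc [w 0 c]mxE; have := geometric_weight_neq0 b.
  have := geometric_weight_neq0 e; rewrite -/w.
  move: (w 0 b) (w 0 e) (lambda ^+ _) => y z l z0 y0; field.
  by rewrite beta_neq0 z0 y0.
move: key; case: (composes b e c); case: (composes e b c) => /= key; try by rewrite key.
by rewrite mulr0n addr0 !mul0r.
Qed.

Lemma weight_in b e c :
  ((composes c b e)%:R + (composes b c e)%:R) * (w 0 e / w 0 b) =
  ((composes c b e)%:R + (composes b c e)%:R) * lambda ^+ height c.
Proof.
have key : composes c b e || composes b c e -> w 0 e / w 0 b = lambda ^+ height c.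
  move=> h; have we : w 0 e = w 0 b * w 0 c / beta.
    by case/orP: h => /geometric_weight_composes -> //; rewrite [X in X / _ = _]mulrC.
  rewrite we [w 0 c]mxE; have := geometric_weight_neq0 b.
  rewrite -/w; move: (w 0 b) (lambda ^+ _) => y l y0.
  by field; rewrite beta_neq0 y0.
move: key; case: (composes c b e); case: (composes b c e) => /= key; try by rewrite key.
by rewrite mulr0n addr0 !mul0r.
Qed.

(** The ratios of weights that enter the curvature of F_c depend only on the
    height h of c, so that the curvature counts brackets: the h - 1
    factorizations of B_c enter with weight 1/2, and its n - 1 - h nonzero
    brackets with weight - 1/2. *)
Theorem ricci_geometric x :
  ricci (frame_metric (@frame_mx R n) geometric_weight) x =
  frame_metric (@frame_mx R n)
    (\row_a (lambda ^+ height a * ((height a)%:R - n%:R / 2))) x.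
Proof.
rewrite (ricci_frame (@smooth_frame_mx R n) (@frame_mx_unit R n) (@frame_mx_mixed R n)
  (@frame_mx_bracket R n) (koszul_torsion structure_const_anti geometric_weight_neq0)
  (koszul_metric structure_const_anti geometric_weight_neq0) geometric_weight_neq0).
rewrite /frame_metric; congr (_ *m _ *m _); apply/matrixP => c d.
rewrite [LHS]mxE (ricci_koszul structure_const_anti geometric_weight_neq0
  structure_const_unimodular structure_const_killing).
transitivity (\sum_b \sum_e (c == d)%:R * lambda ^+ height c *
    (4^-1 * ((composes b e c)%:R + (composes e b c)%:R)
     - 2^-1 * ((composes c b e)%:R + (composes b c e)%:R))).
  apply: eq_bigr => b _; apply: eq_bigr => e _.
  transitivity (4^-1 * (C b e c * C b e d) * (w 0 c * w 0 d / (w 0 b * w 0 e))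
    - 2^-1 * (C c b e * C d b e) * (w 0 e / w 0 b)); first by rewrite !mulrA.
  rewrite structure_const_mul_out structure_const_mul_in.
  case: eqP => [<-|_]; last by rewrite !(mul0r, mulr0) subrr.
  by rewrite !mul1r -(mulrA 4^-1) -(mulrA 2^-1) weight_out weight_in; ring.
under eq_bigr => b _ do rewrite -mulr_sumr sumrB -!mulr_sumr !big_split /=.
rewrite -mulr_sumr sumrB -!mulr_sumr !big_split /=.
rewrite [X in _ * (_ + X) - _]exchange_big /= count_factorizations.
rewrite count_right_multiples count_left_multiples !mxE.
case: eqP => _; last by rewrite mulr0n !mul0r.
rewrite mulr1n mul1r; congr (_ * _).
have := prow_lt_pcol c; have := ltn_ord (pcol c) => cn rc.
have -> : (height c)%:R = (pcol c)%:R - (prow c)%:R :> R by rewrite natrB // ltnW.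
have -> : (n - (pcol c).+1)%:R = n%:R - (pcol c)%:R - 1 :> R.
  by rewrite natrB // -natr1 opprD addrA.
by field.
Qed.

End GeometricMetric.

(** * Left translations, dilations and the flow *)

Section FrameMetric.
Context {R : realType} {m : nat}.
Variables (E : 'rV[R]_m -> 'M[R]_m).
Hypothesis smoothE : smooth_mx E.
Hypothesis unitE : forall x, E x \in unitmx.

Lemma frame_metricE (d : 'rV[R]_m) x i j :
  frame_metric E d x i j = \sum_a d 0 a * (invmx (E x) i a * invmx (E x) j a).
Proof.
rewrite /frame_metric mul_mx_diag mxE; apply: eq_bigr => a _.
by rewrite !mxE mulrAC mulrA mulrC mulrA.
Qed.

Lemma frame_metric_riemannian (d : 'rV[R]_m) :
  (forall a, 0 < d 0 a) -> riemannian_metric (frame_metric E d).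
Proof.
move=> d0; split; [exact: smooth_frame_metric|exact: frame_metricT|] => x v v0.
set u := v *m invmx (E x).
have u0 : u != 0.
  by apply: contraNneq v0 => u0; rewrite -(mulmxKV (unitE x) v) -/u u0 mul0mx.
have -> : v *m frame_metric E d x *m v^T = u *m diag_mx d *m u^T.
  by rewrite /frame_metric trmx_mul !mulmxA.
have -> : (u *m diag_mx d *m u^T) 0 0 = \sum_a d 0 a * u 0 a ^+ 2.
  rewrite mul_mx_diag mxE; apply: eq_bigr => a _.
  by rewrite !mxE mulrAC mulrC expr2.
have [a ua0] : exists a, u 0 a != 0.
  apply/existsP; apply: contraR u0; rewrite negb_exists => /forallP u0.
  by apply/eqP/rowP => a; rewrite [RHS]mxE; apply/eqP; rewrite -[_ == _]negbK.
rewrite (bigD1 a) //= ltr_pwDl //; first by rewrite mulr_gt0 // exprn_even_gt0.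
by apply: sumr_ge0 => b _; rewrite mulr_ge0 ?sqr_ge0 // ltW.
Qed.

Definition jacobian (phi : 'rV[R]_m -> 'rV[R]_m) x : 'M[R]_m :=
  \matrix_(i, k) partial (fun y => phi y 0 k) i x.

(** A map whose differential sends the frame to a diagonal rescaling of itself
    acts on the diagonal metrics of the frame. *)
Lemma pullback_frame_metric phi (s d : 'rV[R]_m) x :
  E x *m jacobian phi x = diag_mx s *m E (phi x) ->
  pullback phi (frame_metric E d) x =
  frame_metric E (\row_a (s 0 a ^+ 2 * d 0 a)) x.
Proof.
move=> ES; rewrite /pullback -/(jacobian phi x) /frame_metric.
have JTh : jacobian phi x *m invmx (E (phi x)) = invmx (E x) *m diag_mx s.
  by rewrite -[in LHS](mulKmx (unitE x) (jacobian phi x)) ES mulmxA mulmxK.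
have -> : diag_mx (\row_a (s 0 a ^+ 2 * d 0 a)) = diag_mx s *m diag_mx d *m (diag_mx s)^T.
  rewrite tr_diag_mx !mulmx_diag; congr diag_mx.
  by apply/rowP => a; rewrite !mxE expr2 mulrAC.
by rewrite !mulmxA JTh -!mulmxA -trmx_mul JTh trmx_mul !mulmxA.
Qed.

End FrameMetric.

Section UnitriangularFlow.
Context {R : realType} {n : nat}.
Hypothesis n_gt0 : (0 < n)%N.
Notation E := (@frame_mx R n).

(** Left multiplication is affine; its differential sends d_i to a B_i, which
    is F_i at a. *)
Lemma jacobian_UTmul (a x : 'rV[R]_(dimUT n)) : jacobian (UTmul a) x = E a.
Proof.
apply/matrixP => i k; rewrite frame_mxE -mulmx_delta -(dmx_UTmx i x) mxE.
have := dmxM i x (smooth_cst_mx (UTmx a)) (@smooth_UTmx R n).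
rewrite dmx_cst mul0mx add0r => /matrixP/(_ (prow k) (pcol k)); rewrite mxE => <-.
by congr partial; apply/funext => y; rewrite mxE.
Qed.

(** F_b is x B_b at x and a x B_b at the translate a x. *)
Lemma frame_mx_UTmul (a x : 'rV[R]_(dimUT n)) : E (UTmul a x) = E x *m E a.
Proof.
apply/matrixP => b k; rewrite frame_mxE UTmxM [RHS]mxE.
transitivity (\sum_i ((pcol i == pcol b)%:R * (UTmx x (prow i) (prow b) *
    (UTmx a (prow k) (prow i) * (pcol k == pcol b)%:R)))); last first.
  apply: eq_bigr => i _; rewrite !frame_mxE.
  by case: eqP => [->|_]; rewrite ?mul1r ?mulr1 // mulr0 !mul0r.
transitivity (\sum_(p < n | (p < pcol b)%N) (UTmx x p (prow b) *
    (UTmx a (prow k) p * (pcol k == pcol b)%:R))); last first.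
  rewrite -(sum_pcol _ (fun p => UTmx x p (prow b) *
    (UTmx a (prow k) p * (pcol k == pcol b)%:R))) big_mkcond.
  by apply: eq_bigr => i _; case: eqP; rewrite ?mul1r ?mul0r.
rewrite mxE mulr_suml [RHS]big_mkcond; apply: eq_bigr => p _; case: ifP => pb.
  by rewrite mulrCA mulrA.
rewrite (UTmx_lower x) ?mulr0 ?mul0r //; apply: leq_trans (prow_lt_pcol b) _.
by rewrite leqNgt pb.
Qed.

Lemma frame_metric_left_invariant (d : 'rV[R]_(dimUT n)) :
  left_invariant (frame_metric E d).
Proof.
move=> a; apply/funext => x.
rewrite (pullback_frame_metric (@frame_mx_unit R n) (s := const_mx 1)).
  by congr frame_metric; apply/rowP => b; rewrite !mxE expr1n mul1r.
rewrite jacobian_UTmul frame_mx_UTmul (_ : diag_mx _ = 1%:M) ?mul1mx //.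
by apply/matrixP => i j; rewrite !mxE.
Qed.

Definition dilation (s : 'rV[R]_(dimUT n)) (x : 'rV[R]_(dimUT n)) : 'rV[R]_(dimUT n) :=
  \row_a (s 0 a * x 0 a).

Lemma smooth_dilation s : smooth_map (dilation s).
Proof.
move=> j; rewrite (_ : (fun x => _) = fun x : 'rV[R]_(dimUT n) => s 0 j * x 0 j); last first.
  by apply/funext => x; rewrite mxE.
by apply: smoothM; [exact: smooth_cst|exact: smooth_coord].
Qed.

Lemma dilation_diffeomorphism (s : 'rV[R]_(dimUT n)) :
  (forall a, s 0 a != 0) -> diffeomorphism (dilation s).
Proof.
move=> s0; exists (dilation (\row_a (s 0 a)^-1)); split.
- by move=> x; apply/rowP => a; rewrite !mxE mulKf.
- by move=> x; apply/rowP => a; rewrite !mxE mulVKf.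
- exact: smooth_dilation.
- exact: smooth_dilation.
Qed.

Lemma jacobian_dilation s x : jacobian (dilation s) x = diag_mx s.
Proof.
apply/matrixP => i k; rewrite !mxE.
rewrite (_ : (fun y => _) = fun y : 'rV[R]_(dimUT n) => s 0 k * y 0 k); last first.
  by apply/funext => y; rewrite mxE.
rewrite /partial deriveMl; last by apply: smooth_derivable; exact: smooth_coord.
rewrite -/(partial _ _ _) partial_coord /GRing.scale /=.
by case: eqP => [->|_]; rewrite ?mulr1 ?mulr0.
Qed.

(** Scaling by powers of the height is an automorphism of the group. *)
Lemma frame_mx_dilation (h : nat -> R) (s x : 'rV[R]_(dimUT n)) :
  h 0%N = 1 -> (forall i j, h (i + j)%N = h i * h j) ->
  (forall a, s 0 a = h (height a)) ->
  E x *m diag_mx s = diag_mx s *m E (dilation s x).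
Proof.
move=> h0 hD sE; apply/matrixP => a b.
rewrite mul_mx_diag mul_diag_mx [LHS]mxE [RHS]mxE !frame_mxE !sE /height.
case: eqP => [eb|_]; last by rewrite !mulr0 mul0r.
rewrite !mulr1 eb; case: (ltngtP (prow b) (prow a)) => [lt|gt|/val_inj ->].
- have [c [cb ca]] := pos_surj lt; rewrite -cb -ca !UTmx_upper mxE sE /height cb ca.
  rewrite mulrA -hD mulrC; congr (h _ * _).
  by rewrite addnBA ?subnK // ltnW // prow_lt_pcol.
- by rewrite !UTmx_lower // mul0r mulr0.
- by rewrite !UTmx_diag mulr1 mul1r.
Qed.

(** The coefficient of the flow at the height k; [flow_weightE] exhibits it as a
    geometric sequence in k. *)
Definition flow_weight (k : nat) (t : R) : R :=
  1 / (n ^ (k - 1))%N%:R * t `^ (1 - 2 * k%:R / n%:R).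

Definition flow_metric (t : R) : 'rV[R]_(dimUT n) -> 'M[R]_(dimUT n) :=
  frame_metric E (\row_a flow_weight (height a) t).

Let ratio (t : R) : R := t `^ (- (2 / n%:R)) / n%:R.

Let n_neq0 : n%:R != 0 :> R.
Proof. by rewrite pnatr_eq0 -lt0n. Qed.

Let powR_exp (t r : R) k : t `^ (r * k%:R) = (t `^ r) ^+ k.
Proof. by rewrite powRrM powR_mulrn // powR_ge0. Qed.

Lemma inv_pow_pred k : (0 < k)%N -> 1 / (n ^ (k - 1))%N%:R = n%:R / n%:R ^+ k :> R.
Proof.
case: k => // k _; rewrite subn1 /= natrX exprS.
by have := expf_neq0 k n_neq0 => nk; field; rewrite nk.
Qed.

Lemma flow_weightE k (t : R) : (0 < k)%N -> 0 < t ->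
  flow_weight k t = n%:R * t * ratio t ^+ k.
Proof.
move=> k0 t0; rewrite /flow_weight inv_pow_pred // /ratio.
rewrite (_ : 1 - _ = 1 + - (2 / n%:R) * k%:R); last by field.
rewrite powRD; last by rewrite (gt_eqF t0) implybT.
rewrite powRr1 ?ltW // powR_exp expr_div_n.
by have := expf_neq0 k n_neq0 => nk; field; rewrite nk.
Qed.

Lemma flow_weight_gt0 k (t : R) : 0 < t -> 0 < flow_weight k t.
Proof.
move=> t0; rewrite /flow_weight mulr_gt0 ?powR_gt0 // divr_gt0 // ltr0n.
by rewrite expn_gt0 n_gt0.
Qed.

Lemma flow_weight_derive k (t : R) : (0 < k)%N -> 0 < t ->
  is_derive t 1 (flow_weight k) (- 2 * (ratio t ^+ k * (k%:R - n%:R / 2))).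
Proof.
move=> k0 t0.
have dp := is_derive1_powR (1 - 2 * k%:R / n%:R) t0.
have -> : - 2 * (ratio t ^+ k * (k%:R - n%:R / 2)) =
    1 / (n ^ (k - 1))%N%:R *:
      ((1 - 2 * k%:R / n%:R) * t `^ (1 - 2 * k%:R / n%:R - 1)).
  rewrite inv_pow_pred // /ratio expr_div_n -powR_exp.
  rewrite (_ : 1 - _ - 1 = - (2 / n%:R) * k%:R); last by field.
  have := expf_neq0 k n_neq0 => nk; rewrite /GRing.scale /=.
  by field; rewrite n_neq0 nk.
exact: is_deriveZ.
Qed.

Lemma flow_metric_geometric (t : R) : 0 < t ->
  flow_metric t = frame_metric E (geometric_weight (n%:R * t) (ratio t)).
Proof.
move=> t0; rewrite /flow_metric; congr frame_metric.
by apply/rowP => a; rewrite !mxE flow_weightE ?height_gt0.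
Qed.

Lemma flow_metric_riemannian (t : R) : 0 < t -> riemannian_metric (flow_metric t).
Proof.
move=> t0; apply: frame_metric_riemannian; [exact: smooth_frame_mx|exact: frame_mx_unit|].
by move=> a; rewrite mxE flow_weight_gt0.
Qed.

Lemma flow_metric_ricci_flow : ricci_flow `]0, +oo[ flow_metric.
Proof.
move=> t; rewrite /= in_itv /= andbT => t0; split; first exact: flow_metric_riemannian.
move=> x i j.
have beta0 : n%:R * t != 0 by rewrite mulf_neq0 // gt_eqF.
have ratio0 : ratio t != 0 by rewrite mulf_neq0 ?invr_neq0 // gt_eqF // powR_gt0.
rewrite flow_metric_geometric // ricci_geometric // frame_metricE mulr_sumr.
set K := fun a => invmx (E x) i a * invmx (E x) j a.
rewrite (_ : (fun s => _) = \sum_a (fun s => flow_weight (height a) s * K a)); last first.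
  by apply/funext => s; rewrite frame_metricE fct_sumE; apply: eq_bigr => a _; rewrite mxE.
apply: is_derive_sum => a.
have da := flow_weight_derive (height_gt0 a) t0.
rewrite [(\row_b _) 0 a]mxE mulrA.
rewrite (_ : (fun s => _) = K a *: flow_weight (height a)); last first.
  by apply/funext => s; rewrite /= mulrC.
by rewrite [X in is_derive _ _ _ X]mulrC; exact: is_deriveZ.
Qed.

(** With q the n-th root of 1/t, the dilation multiplies F_c by q^h, where h is
    the height of c, hence its squared length by q^(2h), and q^2 is the quotient
    of the ratios of the weights at t and at 1. *)
Lemma flow_metric_dilation (t : R) : 0 < t ->
  flow_metric t = fun x =>
    t *: pullback (dilation (\row_a t `^ (- ((height a)%:R / n%:R)))) (flow_metric 1) x.
Proof.
move=> t0; apply/funext => x; set s := \row_a _.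
have sE k : t `^ (- (k%:R / n%:R)) = (t `^ (- n%:R^-1)) ^+ k.
  by rewrite -powR_exp mulNr mulrC.
rewrite /flow_metric (pullback_frame_metric (@frame_mx_unit R n) (s := s)); last first.
  rewrite jacobian_dilation.
  apply: (@frame_mx_dilation (GRing.exp (t `^ (- n%:R^-1)))) => [//|k l|a].
    exact: exprD.
  by rewrite mxE sE.
apply/matrixP => i j; rewrite [RHS]mxE !frame_metricE mulr_sumr; apply: eq_bigr => a _.
rewrite [RHS]mulrA; congr (_ * _); rewrite !mxE !flow_weightE ?height_gt0 //.
rewrite sE /ratio powR1 -exprM mulnC exprM.
rewrite -[_ ^+ 2]powR_exp (_ : - n%:R^-1 * 2%:R = - (2 / n%:R)); last by field.
by rewrite !expr_div_n expr1n; ring.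
Qed.

Lemma sum_tensor_coframe (c : 'I_(dimUT n) -> R) x :
  \sum_a c a *: tensor (coframe x a) (coframe x a) = frame_metric E (\row_a c a) x.
Proof.
apply/matrixP => i j; rewrite frame_metricE summxE; apply: eq_bigr => a _.
by rewrite !mxE big_ord1 !mxE.
Qed.

End UnitriangularFlow.

Theorem theorem1p2 (R : realType) (n : nat) (hn : (2 <= n)%N) :
  let g (t : R) (x : 'rV[R]_(dimUT n)) : 'M[R]_(dimUT n) :=
    \sum_(a < dimUT n)
      (1 / (n ^ (pcol a - prow a - 1))%N%:R
       * t `^ (1 - 2 * (pcol a - prow a)%N%:R / n%:R))
      *: tensor (coframe x a) (coframe x a) in
  let eta (t : R) (x : 'rV[R]_(dimUT n)) : 'rV[R]_(dimUT n) :=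
    \row_(a < dimUT n)
      (t `^ (- ((pcol a - prow a)%N%:R / n%:R)) * x 0 a) in
  [/\ ricci_flow `]0, +oo[ g,
      nilsoliton `]0, +oo[ (g 1) eta &
      forall t : R, 0 < t -> g t = (fun x => t *: pullback (eta t) (g 1) x)].
Proof.
move=> g eta; have n_gt0 : (0 < n)%N := ltnW hn.
have gE : g = flow_metric.
  by apply/funext => t; apply/funext => x; exact: sum_tensor_coframe.
have etaE t : eta t = dilation (\row_a t `^ (- ((height a)%:R / n%:R))).
  by apply/funext => x; apply/rowP => a; rewrite !mxE.
have scaling t : 0 < t -> g t = (fun x => t *: pullback (eta t) (g 1) x).
  by move=> t0; rewrite gE etaE; exact: flow_metric_dilation.
have flow : ricci_flow `]0, +oo[ g by rewrite gE; exact: flow_metric_ricci_flow.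
split=> //; split.
- by rewrite gE; exact: flow_metric_riemannian.
- by rewrite gE; exact: frame_metric_left_invariant.
- move=> t; rewrite /= in_itv /= andbT => t0; rewrite etaE.
  by apply: dilation_diffeomorphism => a; rewrite mxE gt_eqF // powR_gt0.
(* The time derivative transfers because the two families agree near t, although
   they may differ at nonpositive times. *)
exists id => t Dt; have [met dg] := flow t Dt.
move: Dt; rewrite /= in_itv /= andbT => t0; rewrite -scaling //; split=> // x i j.
apply: near_eq_is_derive (dg x i j).
near=> s; rewrite scaling //; near: s; exact: lt_nbhsr t0.
Unshelve. all: by end_near. Qed.
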